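(* Let $T\ge1$ be an integer, $C>4$, $\beta>0$, and run the randomized incremental proximal method $x_{t+1}=\operatorname{prox}_{\tau m g_{j_t}}(x_t-\tau\nabla f_{i_t}(x_t))$ from a deterministic $x_0$ with $\tau=\frac{1}{CLT^\beta}$. Then \begin{align*} \mathbb{E}[h(x_{T+1})-h^*]&\le A\Bigg[\frac{CL\,\mathbb{E}\|x_0-x^*\|^2}{T^{1-\beta}}+\frac{2}{T}\mathbb{E}[h(x_0)-h^*]+\frac{4\sigma_*^2}{(C-2)LT^{1+\beta}}+\frac{16\sigma_*^2\ln(T+1)}{(C-2)LT^\beta}\\ &\qquad+\frac{16m^2L_g^2}{CLT^{1+\beta}}+\frac{64m^2L_g^2\ln(T+1)}{CLT^\beta}\Bigg], \end{align*} where $A=\exp\!\left(\frac{4}{e\beta C}\right)$.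
   Context: Let $D$ be a probability distribution on an index set, and for each index $i$ let $f_i:\mathbb{R}^n\to\mathbb{R}$ be convex and differentiable with $L$-Lipschitz gradient ($L>0$). Let $f(x)=\mathbb{E}_{i\sim D}[f_i(x)]$ with $\mathbb{E}_{i\sim D}[\nabla f_i(x)]=\nabla f(x)$. Let $g=\sum_{j=1}^m g_j$ with each $g_j:\mathbb{R}^n\to\mathbb{R}$ proper, convex, lower semicontinuous and $L_g$-Lipschitz. Let $h=f+g$, assume $\arg\min h\neq\emptyset$, $h^*=\min h$, and let $x^*\in\arg\min h$ be such that $\sigma_*^2:=\mathbb{E}_{i\sim D}\|\nabla f_i(x^* )\|^2<\infty$. $\operatorname{prox}_{\lambda\phi}(y)=\arg\min_z\{\lambda\phi(z)+\tfrac12\|y-z\|^2\}$. At each iteration $i_t\sim D$ and $j_t$ uniform on $\{1,\dots,m\}$, independent of each other and of $x_0,\dots,x_t$. *)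

(* Defs.v *)
From HB Require Import structures.
From mathcomp Require Import all_boot all_order all_algebra.
From mathcomp Require Import all_classical all_reals all_analysis.
Set Implicit Arguments. Unset Strict Implicit. Unset Printing Implicit Defensive.
Import Order.TTheory GRing.Theory Num.Theory.
Import numFieldNormedType.Exports.
Local Open Scope ring_scope.

Section Defs.
Variables (R : realType) (n : nat).

Definition dotv (u v : 'rV[R]_n) : R := \sum_(k < n) u 0 k * v 0 k.
Definition sqnorm (v : 'rV[R]_n) : R := dotv v v.
Definition enorm (v : 'rV[R]_n) : R := Num.sqrt (sqnorm v).

Definition convex_fun (phi : 'rV[R]_n -> R) : Prop :=
  forall (x y : 'rV[R]_n) (t : R), 0 <= t -> t <= 1 ->
    phi (t *: x + (1 - t) *: y) <= t * phi x + (1 - t) * phi y.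

(* z = prox_{lam phi}(y) : z minimizes w |-> lam phi w + 1/2 ||y - w||^2
   (the minimizer is unique for convex real-valued phi and lam > 0) *)
Definition is_prox (lam : R) (phi : 'rV[R]_n -> R) (y z : 'rV[R]_n) : Prop :=
  forall w, lam * phi z + 2^-1 * sqnorm (y - z) <= lam * phi w + 2^-1 * sqnorm (y - w).

Definition is_gradient (phi : 'rV[R]_n -> R) (gr : 'rV[R]_n -> 'rV[R]_n) : Prop :=
  forall x, differentiable phi x /\ forall v, 'D_v phi x = dotv (gr x) v.

End Defs.

(* Main.v *)
Require Import Defs.
From HB Require Import structures.
From mathcomp Require Import all_boot all_order all_algebra.
From mathcomp Require Import all_classical all_reals all_analysis.
From mathcomp Require Import measurable_realfun ring lra.
Import Order.TTheory GRing.Theory Num.Theory.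
Import numFieldNormedType.Exports.
Local Open Scope classical_set_scope.
Local Open Scope ring_scope.

(** The proximal step and cocoercivity of the gradients give, for every point
    [z] determined by the past, with [a_t := h (x t) - h xs],
    [E|x_{t+1} - z|^2 <= E|x_t - z|^2 - 2 tau E(h x_t - h z) + 2 tau dl E a_t
    + 2 tau^2 V], where [dl = 4/3 L tau] and [V = 8/3 sigma2 + 8 m^2 Lg^2].
    Taking [z = x_{N-k}] and telescoping up to [N = T + 1], the mean [S_k] of
    the last [k + 1] values of [E a_t] satisfies
    [S_{k-1} <= (1 + dl / k) S_k + tau V / k], so that [E a_N = S_0] is at most
    [prod_k (1 + dl / k) (S_N + tau V sum_k 1 / k)]; taking [z = xs] bounds
    [S_N].  Finally [dl = 4 / (3 C T^beta)] and [ln T <= T^beta / (e beta)]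
    bound the product by [exp (4 / (e beta C))].

    Conditional expectations are replaced by Tonelli's theorem: the one-step
    bound is nonnegative for all values of the indices, not only along the
    trajectory, so no integrability is needed beforehand, and the finiteness of
    the second moments follows by induction on [t]. *)

Set Implicit Arguments.
Unset Strict Implicit.
Unset Printing Implicit Defensive.

(** * Convex functions, smooth gradients and the proximal step in Euclidean space *)

Section euclidean.
Context {R : realType} {n : nat}.
Implicit Types (u v w x y z : 'rV[R]_n) (a s : R).

Lemma dotvC u v : dotv u v = dotv v u.
Proof. by apply: eq_bigr => k _; rewrite mulrC. Qed.

Lemma dotvDl u v w : dotv (u + v) w = dotv u w + dotv v w.
Proof. by rewrite -big_split; apply: eq_bigr => k _; rewrite mxE mulrDl. Qed.

Lemma dotvZl a u v : dotv (a *: u) v = a * dotv u v.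
Proof. by rewrite mulr_sumr; apply: eq_bigr => k _; rewrite mxE mulrA. Qed.

Lemma dotvNl u v : dotv (- u) v = - dotv u v.
Proof. by rewrite -scaleN1r dotvZl mulN1r. Qed.

Lemma dotvDr u v w : dotv u (v + w) = dotv u v + dotv u w.
Proof. by rewrite dotvC dotvDl !(dotvC u). Qed.

Lemma dotvZr a u v : dotv u (a *: v) = a * dotv u v.
Proof. by rewrite dotvC dotvZl dotvC. Qed.

Lemma dotvNr u v : dotv u (- v) = - dotv u v.
Proof. by rewrite dotvC dotvNl dotvC. Qed.

Definition dotvE := (dotvDl, dotvDr, dotvNl, dotvNr, dotvZl, dotvZr).

Lemma sqnorm_ge0 u : 0 <= sqnorm u.
Proof. by apply: sumr_ge0 => k _; rewrite -expr2 sqr_ge0. Qed.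

Lemma sqnorm0 : sqnorm (0 : 'rV[R]_n) = 0.
Proof. by apply: big1 => k _; rewrite mxE mul0r. Qed.

Lemma sqr_enorm u : enorm u ^+ 2 = sqnorm u.
Proof. by rewrite sqr_sqrtr ?sqnorm_ge0. Qed.

Lemma enorm_ge0 u : 0 <= enorm u.
Proof. exact: sqrtr_ge0. Qed.

Lemma dotv_young a u v : 0 < a -> 2 * dotv u v <= a * sqnorm u + a^-1 * sqnorm v.
Proof.
move=> a0; have := sqnorm_ge0 (a *: u - v).
rewrite /sqnorm !dotvE (dotvC v u) => h.
rewrite -(ler_pM2l a0).
have -> : a * (a * dotv u u + a^-1 * dotv v v) = a * (a * dotv u u) + dotv v v.
  by rewrite mulrDr [in X in _ + X]mulrA divff ?mul1r// gt_eqF.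
lra.
Qed.

Lemma sqnormB_le u v w : sqnorm (u - v) <= 2 * sqnorm (u - w) + 2 * sqnorm (v - w).
Proof.
have := sqnorm_ge0 ((u - w) + (v - w)).
have -> : u - v = (u - w) - (v - w) by rewrite opprB addrA subrK.
move: (u - w) (v - w) => p q; rewrite /sqnorm !dotvE (dotvC q p); lra.
Qed.

Lemma ler_vanish (a b c : R) :
  (forall s, 0 < s -> s <= 1 -> a <= b + s * c) -> a <= b.
Proof.
move=> H; rewrite leNgt; apply/negP => ba.
have c0 : 0 < c by have := H 1 ltr01 (lexx _); lra.
(* With this [s] the error [s * c] is at most half of the positive gap [a - b], which contradicts
   the bound. *)
pose s := Num.min 1 ((a - b) / (2 * c)).
have s0 : 0 < s by rewrite lt_min ltr01 /= divr_gt0//; lra.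
have s1 : s <= 1 by rewrite ge_min lexx.
have : s * c <= (a - b) / 2.
  have -> : (a - b) / 2 = (a - b) / (2 * c) * c by field; rewrite gt_eqF.
  by rewrite ler_pM2r// ge_min lexx orbT.
have := H s s0 s1; lra.
Qed.

(** The quotients are controlled only for [s > 0]; this suffices because derivability makes the
    derivative equal to the right limit. *)
Lemma derive_le_ray (F : 'rV[R]_n -> R) x v c : derivable F x v ->
  (forall s, 0 < s -> s <= 1 -> F (x + s *: v) - F x <= s * c) -> 'D_v F x <= c.
Proof.
move=> dF H; rewrite /derive cvg_at_rightE//.
apply: limr_le.
  by apply/cvg_ex; exists ('D_v F x); apply: cvg_dnbhs_at_right.
near=> s.
have s0 : 0 < s by near: s; exact: nbhs_right_gt.
have s1 : s <= 1 by near: s; exact: nbhs_right_le.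
rewrite /= [s *: v + x]addrC; have := H s s0 s1.
by move=> h; rewrite -[X in X <= _]/(s^-1 * (_ - _)) ler_pdivrMl.
Unshelve. all: by end_near. Qed.

Lemma derive_ge_ray (F : 'rV[R]_n -> R) x v c : derivable F x v ->
  (forall s, 0 < s -> s <= 1 -> s * c <= F (x + s *: v) - F x) -> c <= 'D_v F x.
Proof.
move=> dF H; rewrite -lerN2 -deriveN//; apply: derive_le_ray => [|s s0 s1].
  exact: derivableN.
rewrite !fctE; have := H s s0 s1; lra.
Qed.

Lemma gradient_derivable (F : 'rV[R]_n -> R) (GF : 'rV[R]_n -> 'rV[R]_n) x v :
  is_gradient F GF -> derivable F x v.
Proof. by move=> /(_ x)[dF _]; exact: diff_derivable. Qed.

Lemma gradient_continuous (F : 'rV[R]_n -> R) (GF : 'rV[R]_n -> 'rV[R]_n) :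
  is_gradient F GF -> continuous F.
Proof. by move=> gF x; apply: differentiable_continuous; have [] := gF x. Qed.

Lemma ray_convexE x y s : x + s *: (y - x) = s *: y + (1 - s) *: x.
Proof. by rewrite scalerBr scalerBl scale1r addrCA. Qed.

Lemma convex_gradient_le (F : 'rV[R]_n -> R) (GF : 'rV[R]_n -> 'rV[R]_n) x y :
  convex_fun F -> is_gradient F GF -> F x + dotv (GF x) (y - x) <= F y.
Proof.
move=> cF gF; rewrite -lerBrDl; have [_ <-] := gF x.
apply: derive_le_ray => [|s s0 s1]; first exact: gradient_derivable gF.
by rewrite ray_convexE; have := cF y x s (ltW s0) s1; lra.
Qed.

(** The difference quotient of the restriction to the ray coincides with that of [F] at [x + s *: v]
    in the direction [v]. *)
Lemma is_derive_ray (F : 'rV[R]_n -> R) (GF : 'rV[R]_n -> 'rV[R]_n) x v s :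
  is_gradient F GF ->
  is_derive s 1 (fun r => F (x + r *: v)) (dotv (GF (x + s *: v)) v).
Proof.
move=> gF; have dF := @gradient_derivable F GF (x + s *: v) v gF.
have E : (fun h => h^-1 *: (((fun r => F (x + r *: v)) \o shift s) (h *: 1)
            - F (x + s *: v))) =
         (fun h => h^-1 *: ((F \o shift (x + s *: v)) (h *: v) - F (x + s *: v))).
  apply/funext => h /=; congr (_ *: (F _ - _)).
  by rewrite -[h *: 1]/(h * 1) mulr1 scalerDl addrCA.
apply: DeriveDef; first by rewrite /derivable E.
by rewrite /derive E -/('D_v F _); have [_ ->] := gF (x + s *: v).
Qed.

Lemma descent_lemma (F : 'rV[R]_n -> R) (GF : 'rV[R]_n -> 'rV[R]_n) (L : R) x y :
  0 < L -> is_gradient F GF ->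
  (forall u v, enorm (GF u - GF v) <= L * enorm (u - v)) ->
  F y <= F x + dotv (GF x) (y - x) + L / 2 * sqnorm (y - x).
Proof.
move=> L0 gF lF; set d := y - x.
(* Subtracting the linear and quadratic terms of the claim makes the derivative of [psi] nonpositive
   on [[0, 1]]; the mean value theorem then gives [psi 1 <= psi 0], in place of the usual integral
   of the gradient. *)
pose psi r := F (x + r *: d) - (r * dotv (GF x) d + L / 2 * sqnorm d * r ^+ 2).
have dpsi (s : R) : is_derive s 1 psi
    (dotv (GF (x + s *: d)) d - (dotv (GF x) d + L * sqnorm d * s)).
  have dF := is_derive_ray x d s gF.
  rewrite /psi; apply: is_derive_eq.
  by congr (_ - _); rewrite /GRing.scale /=; field.
have cpsi : {within `[0, 1], continuous psi}.
  apply: derivable_within_continuous => s _.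
  by case: (dpsi s).
have [c] := MVT_segment (@ler01 R) (fun s _ => dpsi s) cpsi.
rewrite in_itv /= => /andP[c0 c1].
rewrite /psi scale1r scale0r addr0 mul0r expr0n mulr0 addr0 expr1n.
have xd : x + d = y by rewrite /d addrC subrK.
rewrite xd subr0 mulr1 => E.
suff : dotv (GF (x + c *: d)) d - dotv (GF x) d <= L * sqnorm d * c.
  by move: E; lra.
case: (ltrgtP 0 c) c0 => // [{}c0|<-] _; last first.
  by rewrite scale0r addr0 subrr mulr0.
(* The weight [(L * c)^-1] makes both terms of Young's inequality at most [L * c * sqnorm d], which
   replaces Cauchy-Schwarz; [c = 0] was split off because it admits no such weight. *)
have := dotv_young (GF (x + c *: d) - GF x) d (_ : 0 < (L * c)^-1).
rewrite invr_gt0 mulr_gt0// invrK => /(_ isT).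
have : sqnorm (GF (x + c *: d) - GF x) <= (L * c) ^+ 2 * sqnorm d.
  rewrite -!sqr_enorm.
  have -> : (L * c) ^+ 2 * enorm d ^+ 2 = (L * (c * enorm d)) ^+ 2 by ring.
  rewrite ler_sqr ?nnegrE ?enorm_ge0 ?mulr_ge0 ?(ltW L0) ?(ltW c0) ?enorm_ge0//.
  have -> : c * enorm d = enorm (x + c *: d - x); last exact: lF.
  rewrite addrC addKr /enorm /sqnorm dotvZl dotvZr mulrA -expr2.
  by rewrite sqrtrM ?sqr_ge0// sqrtr_sqr gtr0_norm.
move=> h; rewrite dotvDl dotvNl.
have : (L * c)^-1 * sqnorm (GF (x + c *: d) - GF x) <= L * c * sqnorm d.
  rewrite ler_pdivrMl ?mulr_gt0//; apply: le_trans h _.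
  by rewrite expr2 -!mulrA.
lra.
Qed.

Definition bregman (F : 'rV[R]_n -> R) (GF : 'rV[R]_n -> 'rV[R]_n) x y : R :=
  F x - F y - dotv (GF y) (x - y).

(** Let [z] be reached from [x] by a step [L^-1] along [- D], with [D] the difference of the
    gradients. The tangent at [y] bounds [F z] below and the descent lemma at [x] bounds it above;
    the comparison leaves [sqnorm D / (2 * L)]. *)
Lemma gradient_cocoercive (F : 'rV[R]_n -> R) (GF : 'rV[R]_n -> 'rV[R]_n) (L : R) x y :
  0 < L -> convex_fun F -> is_gradient F GF ->
  (forall u v, enorm (GF u - GF v) <= L * enorm (u - v)) ->
  sqnorm (GF x - GF y) <= 2 * L * bregman F GF x y.
Proof.
move=> L0 cF gF lF; rewrite /bregman.
have [D DE] : exists D, D = GF x - GF y by eexists.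
rewrite -DE; pose z := x - L^-1 *: D.
have h1 := convex_gradient_le y z cF gF.
have h2 := descent_lemma x z L0 gF lF.
have zx : z - x = - (L^-1 *: D) by rewrite /z addrAC subrr add0r.
have zy : z - y = (x - y) - L^-1 *: D by rewrite /z addrAC.
rewrite zy !dotvE in h1; rewrite zx /sqnorm !dotvE -/(sqnorm D) in h2.
have E : dotv (GF x) D - dotv (GF y) D = sqnorm D.
  by rewrite -dotvNl -dotvDl -DE.
have h3 : L^-1 * sqnorm D - L / 2 * (L^-1 * (L^-1 * sqnorm D)) = sqnorm D / (2 * L).
  by field; rewrite gt_eqF.
have h4 : sqnorm D / (2 * L) <= F x - F y - dotv (GF y) (x - y).
  have E' : L^-1 * dotv (GF x) D - L^-1 * dotv (GF y) D = L^-1 * sqnorm D.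
    by rewrite -mulrBr E.
  by rewrite -h3 dotvDr dotvNr; lra.
by move: h4; rewrite ler_pdivrMr ?mulr_gt0// mulrC.
Qed.

(** Testing the minimality of [p] at the points [p + s *: (z - p)] and letting [s] vanish gives the
    variational inequality [key]; the three squares come from expanding [sqnorm (y - z)] around
    [p]. *)
Lemma prox_ineq (lam : R) (phi : 'rV[R]_n -> R) y p z : 0 < lam -> convex_fun phi ->
  is_prox lam phi y p ->
  2 * lam * (phi p - phi z) <= sqnorm (y - z) - sqnorm (y - p) - sqnorm (p - z).
Proof.
move=> lam0 cphi prx.
have key : lam * (phi p - phi z) <= dotv (y - p) (p - z).
  apply: (@ler_vanish _ _ (sqnorm (z - p) / 2)) => s s0 s1.
  have h := prx (p + s *: (z - p)).
  have := cphi z p s (ltW s0) s1; rewrite -ray_convexE => hc.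
  move: hc h; rewrite opprD addrA -(opprB z p) dotvNr.
  move: (y - p) (z - p) => u v; move: (phi (p + s *: v)) (phi p) (phi z) => a b c.
  rewrite /sqnorm !dotvE (dotvC v u) => hc h.
  have h5 : lam * a <= lam * (s * c + (1 - s) * b) by rewrite ler_pM2l.
  rewrite -(ler_pM2l s0).
  by move: h h5; lra.
have -> : y - z = (y - p) + (p - z) by rewrite addrA subrK.
move: key; move: (y - p) (p - z) => u v.
by rewrite /sqnorm !dotvE (dotvC v u); lra.
Qed.

(* The factor [16/15] comes from [step_young], and [5/2 L] and [5] from
   [gradient_sqnorm_le]: [16/15 * 5/2 = 8/3] and [16/15 * 5 = 16/3]. *)
Definition step_bound (tau M Lg L : R) (F : 'rV[R]_n -> R)
    (GF : 'rV[R]_n -> 'rV[R]_n) (g : 'rV[R]_n -> R) (xs x z : 'rV[R]_n) : R :=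
  sqnorm (x - z) - 2 * tau * (F x - F z) - 2 * tau * M * (g x - g z)
  + tau ^+ 2 * (8 / 3 * L * bregman F GF x xs + 16 / 3 * sqnorm (GF xs))
  + 16 * tau ^+ 2 * M ^+ 2 * Lg ^+ 2.

(** Young's inequality with weight [1/4] on the cross term gives the factors [5/4] and [5];
    cocoercivity turns [5/4] into [5/2 * L]. *)
Lemma gradient_sqnorm_le (F : 'rV[R]_n -> R) (GF : 'rV[R]_n -> 'rV[R]_n) (L : R) x xs :
  0 < L -> convex_fun F -> is_gradient F GF ->
  (forall u v, enorm (GF u - GF v) <= L * enorm (u - v)) ->
  sqnorm (GF x) <= 5 / 2 * L * bregman F GF x xs + 5 * sqnorm (GF xs).
Proof.
move=> L0 cF gF lF; have h := gradient_cocoercive x xs L0 cF gF lF.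
have := @dotv_young (4^-1) (GF x - GF xs) (GF xs) _.
have -> : sqnorm (GF x) = sqnorm (GF x - GF xs) + 2 * dotv (GF x - GF xs) (GF xs)
            + sqnorm (GF xs).
  by rewrite /sqnorm !dotvE (dotvC (GF xs)); ring.
rewrite invr_gt0 ltr0n => /(_ isT); rewrite invrK.
by move: (GF x - GF xs) h => d h; lra.
Qed.

(* Young's inequality with the weights [15/16 + 1/16 = 1] on [sqnorm d]. *)
Lemma step_young (tau M Lg : R) (G d : 'rV[R]_n) :
  2 * tau * dotv G d + 2 * tau * M * (Lg * enorm d) <=
  sqnorm d + 16 / 15 * tau ^+ 2 * sqnorm G + 16 * tau ^+ 2 * M ^+ 2 * Lg ^+ 2.
Proof.
have := @dotv_young (16 / 15) (tau *: G) d _.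
rewrite divr_gt0// => /(_ isT); rewrite /sqnorm !dotvE -/(sqnorm _) -/(sqnorm _) invf_div.
have := sqr_ge0 (16 * tau * M * Lg - enorm d); rewrite -(sqr_enorm d).
by move: (sqnorm G) (dotv G d) => a b; nra.
Qed.

Section step.
Variables (tau M Lg L : R) (F : 'rV[R]_n -> R) (GF : 'rV[R]_n -> 'rV[R]_n).
Variables (g : 'rV[R]_n -> R) (xs : 'rV[R]_n).
Hypotheses (tau0 : 0 < tau) (M0 : 0 < M) (L0 : 0 < L).
Hypotheses (cF : convex_fun F) (gF : is_gradient F GF).
Hypothesis lF : forall u v, enorm (GF u - GF v) <= L * enorm (u - v).
Hypothesis cg : convex_fun g.
Hypothesis lg : forall u v, `|g u - g v| <= Lg * enorm (u - v).

Let grad_part x : 16 / 15 * tau ^+ 2 * sqnorm (GF x) <=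
  tau ^+ 2 * (8 / 3 * L * bregman F GF x xs + 16 / 3 * sqnorm (GF xs)).
Proof.
have := ler_wpM2l (sqr_ge0 tau) (gradient_sqnorm_le x xs L0 cF gF lF).
by move: (tau ^+ 2) => t; lra.
Qed.

Let lipr u v : 2 * tau * M * (g u - g v) <= 2 * tau * M * (Lg * enorm (u - v)).
Proof. by rewrite ler_pM2l ?mulr_gt0//; exact: le_trans (ler_norm _) (lg u v). Qed.

Let convr x z : 2 * tau * (F x - F z) <= 2 * tau * dotv (GF x) (x - z).
Proof.
rewrite ler_pM2l ?mulr_gt0//; have := convex_gradient_le x z cF gF.
by rewrite -(opprB x z) dotvNr; lra.
Qed.

(** This is [step_young] with [d = x - z]. Since no proximal point is involved, it holds for all
    indices at once, as Tonelli's theorem requires. *)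
Lemma step_bound_ge0 x z : 0 <= step_bound tau M Lg L F GF g xs x z.
Proof.
have := step_young tau M Lg (GF x) (x - z).
by have := grad_part x; have := lipr x z; have := convr x z; rewrite /step_bound; lra.
Qed.

(** Lipschitz continuity trades [g p] in the proximal inequality for [g x] at the cost of
    [Lg * enorm (x - p)]. By [step_young] with [d = x - p], this cost and the gradient term are
    absorbed by [- sqnorm (x - p)], up to noise of order [tau ^+ 2]. *)
Lemma step_bound_prox x z p : is_prox (tau * M) g (x - tau *: GF x) p ->
  sqnorm (p - z) <= step_bound tau M Lg L F GF g xs x z.
Proof.
move=> prx; have := prox_ineq z (mulr_gt0 tau0 M0) cg prx.
have -> : x - tau *: GF x - z = (x - z) - tau *: GF x by rewrite addrAC.
have -> : x - tau *: GF x - p = (x - p) - tau *: GF x by rewrite addrAC.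
have -> : sqnorm (x - z - tau *: GF x) = sqnorm (x - z)
    - 2 * tau * dotv (GF x) (x - z) + tau ^+ 2 * sqnorm (GF x).
  by move: (x - z) => d; rewrite /sqnorm !dotvE (dotvC d); ring.
have -> : sqnorm (x - p - tau *: GF x) = sqnorm (x - p)
    - 2 * tau * dotv (GF x) (x - p) + tau ^+ 2 * sqnorm (GF x).
  by move: (x - p) => d; rewrite /sqnorm !dotvE (dotvC d); ring.
have := step_young tau M Lg (GF x) (x - p).
by have := grad_part x; have := lipr x p; have := convr x z; rewrite /step_bound; lra.
Qed.

End step.

(** First-order optimality with only [f] differentiable: [- Gf xs] is a subgradient of [g] at [xs],
    as seen by moving a little from [xs] towards [x]. *)
Lemma minimizer_gradient_ge (f g : 'rV[R]_n -> R) (Gf : 'rV[R]_n -> 'rV[R]_n) xs x :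
  is_gradient f Gf -> convex_fun g -> (forall y, f xs + g xs <= f y + g y) ->
  g xs - g x <= dotv (Gf xs) (x - xs).
Proof.
move=> gf cg mxs; have [_ <-] := gf xs.
apply: derive_ge_ray => [|s s0 s1]; first exact: gradient_derivable gf.
have := mxs (xs + s *: (x - xs)); rewrite ray_convexE.
by have := cg x xs s (ltW s0) s1; lra.
Qed.

End euclidean.

(** * Measurability of functions measurable in one argument and continuous in the other *)

Section caratheodory.
Context {R : realType} {n : nat}.

Definition grid_index (k : nat) (v : 'rV[R]_n) : 'rV[int]_n :=
  \row_j Num.floor (k.+1%:R * v 0 j).

Definition grid_point (k : nat) (z : 'rV[int]_n) : 'rV[R]_n :=
  \row_j ((z 0 j)%:~R / k.+1%:R).

Lemma grid_cvg (v : 'rV[R]_n) : grid_point k (grid_index k v) @[k --> \oo] --> v.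
Proof.
apply/cvgrPdist_lt => e e0; near=> k.
have k0 : 0 < k.+1%:R :> R by rewrite ltr0n.
rewrite -[`|_|]/(mx_norm _) mx_normrE; apply/bigmax_ltP; split => // -[a j] _ /=.
rewrite !mxE (ord1 a).
have /andP[h1 h2] := Num.Theory.floor_itv (k.+1%:R * v 0 j).
have fle : (Num.floor (k.+1%:R * v 0 j))%:~R / k.+1%:R <= v 0 j.
  by rewrite ler_pdivrMr// [leRHS]mulrC.
rewrite ger0_norm ?subr_ge0//.
have : v 0 j < ((Num.floor (k.+1%:R * v 0 j))%:~R + 1) / k.+1%:R.
  by rewrite ltr_pdivlMr// [ltLHS]mulrC; move: h2; rewrite intrD.
rewrite mulrDl mul1r => h3.
have : k.+1%:R^-1 < e by near: k; exact: near_infty_natSinv_lt (PosNum e0).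
move: (k.+1%:R^-1) h3 => ik h3; lra.
Unshelve. all: by end_near. Qed.

(* Rounding [y] to a countable grid turns preimages into countable unions of
   measurable sets; continuity of [Phi t] lets the mesh tend to [0]. *)
Lemma measurable_caratheodory d (T : measurableType d) (Phi : T -> 'rV[R]_n -> R)
    (y : T -> 'rV[R]_n) :
  (forall v, measurable_fun setT (Phi^~ v)) -> (forall t, continuous (Phi t)) ->
  (forall j, measurable_fun setT (fun t => y t 0 j)) ->
  measurable_fun setT (fun t => Phi t (y t)).
Proof.
move=> mPhi cPhi my.
apply: (@measurable_fun_cvg _ _ _ _
  (fun k t => Phi t (grid_point k (grid_index k (y t))))) => [k|t _]; last first.
  by apply: continuous_cvg; [exact: cPhi|exact: grid_cvg].
move=> _ B mB.
have -> : setT `&` (fun t => Phi t (grid_point k (grid_index k (y t)))) @^-1` B =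
  \bigcup_(z : 'rV[int]_n) ((Phi^~ (grid_point k z)) @^-1` B `&`
     \bigcap_(j in [set: 'I_n]) ((fun t => y t 0 j) @^-1`
        [set r | Num.floor (k.+1%:R * r) = z 0 j])).
  apply/seteqP; split => [t [_ /= Bt]|t [z _ [/= Bt zj]]].
    exists (grid_index k (y t)) => //; split => // j _ /=; by rewrite mxE.
  split => //=; have -> // : grid_index k (y t) = z.
  by apply/rowP => j; rewrite mxE zj.
apply: countable_bigcupT_measurable => [|z]; first exact: countableP.
apply: measurableI.
  by rewrite -[X in measurable X]setTI; exact: mPhi.
apply: fin_bigcap_measurable => // j _.
rewrite -[X in measurable X]setTI; apply: my => //.
have p : 0 < k.+1%:R :> R by rewrite ltr0n.
have -> : [set r : R | Num.floor (k.+1%:R * r) = z 0 j] =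
  [set` `[(z 0 j)%:~R / k.+1%:R, ((z 0 j + 1)%:~R) / k.+1%:R[ ].
  apply/seteqP; split => r /=; rewrite in_itv /= ler_pdivrMr// ltr_pdivlMr// mulrC.
    move=> <-; exact: Num.Theory.floor_itv.
  by move=> /Num.Theory.floor_def.
exact: measurable_itv.
Qed.

End caratheodory.

(** * Integration over an index that is independent of the past *)

Section independent_tonelli.
Context {R : realType} {dO dI : measure_display}.
Context {Omega : measurableType dO} {I : measurableType dI}.
Variables (P : probability Omega R) (D : probability I R).

Lemma ge0_integral_mrestr (E : set Omega) (mE : measurable E) (f : Omega -> \bar R) :
  measurable_fun setT f -> (forall w, 0 <= f w)%E ->
  (\int[mrestr P mE]_w f w = \int[P]_(w in E) f w)%E.
Proof.
move=> mf f0; rewrite -(setUv E) ge0_integral_setU//=; last 3 first.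
- exact: measurableC.
- by rewrite setUv.
- exact/disj_set2P/setICr.
have -> : (\int[mrestr P mE]_(w in E) f w = \int[P]_(w in E) f w)%E.
  apply: eq_measure_integral => A mA AE.
  by rewrite /= /mrestr setIidl.
rewrite [X in (_ + X)%E]null_set_integral ?adde0//.
- exact: measurableC.
- exact: measurable_funTS.
- by rewrite /= /mrestr setICl measure0.
Qed.

Definition history_rects (G : set (set Omega)) : set (set (Omega * I)) :=
  [set X | exists B A, [/\ G B, measurable A & X = B `*` A]].

(* [Omega * I] with only the events of the history [G] visible on [Omega]. *)
Definition history (G : set (set Omega)) := g_sigma_algebraType (history_rects G).

Variable G : set (set Omega).
Hypotheses (GI : setI_closed G) (GT : G setT) (mG : G `<=` measurable).

Lemma history_rects_measurable B A : G B -> measurable A ->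
  measurable (B `*` A : set (history G)).
Proof. by move=> GB mA; apply: sub_sigma_algebra; exists B, A. Qed.

Lemma measurable_history_id :
  measurable_fun setT (id : Omega * I -> history G).
Proof.
apply: (@measurability _ _ _ (history G) _ _ (history_rects G)) => //.
move=> _ [_ [B [A [GB mA ->]]] <-].
by rewrite setTI preimage_id; apply: measurableX => //; exact: mG.
Qed.

Lemma measurable_history_graph (i : Omega -> I) : measurable_fun setT i ->
  measurable_fun setT ((fun w => (w, i w)) : Omega -> history G).
Proof.
move=> mi; apply: (@measurability _ _ _ (history G) _ _ (history_rects G)) => //.
move=> _ [_ [B [A [GB mA ->]]] <-].
rewrite setTI [X in measurable X](_ : _ = B `&` (setT `&` i @^-1` A)).
  by apply: measurableI; [exact: mG|exact: mi].
by apply/seteqP; split => w /= => [[]|[? []]].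
Qed.

Lemma measurable_history_snd :
  measurable_fun setT (snd : history G -> I).
Proof.
move=> _ A mA; rewrite setTI [X in measurable X](_ : _ = setT `*` A).
  exact: history_rects_measurable.
by apply/seteqP; split => -[w i] /= => [|[]].
Qed.

Lemma measurable_history_fst d (T : measurableType d) (f : Omega -> T) :
  (forall A, measurable A -> G (f @^-1` A)) ->
  measurable_fun setT ((fun p => f p.1) : history G -> T).
Proof.
move=> Gf _ A mA; rewrite setTI [X in measurable X](_ : _ = f @^-1` A `*` setT).
  by apply: history_rects_measurable => //; exact: Gf.
by apply/seteqP; split => -[w i] /= => [|[]].
Qed.

(** The law of [(w, i w)] under [P] restricted to [E] and [c] times the product of [P] and [D] agree
    on the rectangles over [G]. These form a pi-system generating the sigma-algebra of [history G],
    so the two measures agree on it, and [Psi] is measurable for it. *)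
Lemma independent_tonelli (i : Omega -> I) (E : set Omega) (c : R)
    (Psi : Omega * I -> \bar R) :
  measurable_fun setT i -> measurable E -> 0 <= c ->
  (forall A B, measurable A -> G B ->
     P (E `&` i @^-1` A `&` B) = (c%:E * (P B * D A))%E) ->
  measurable_fun setT (Psi : history G -> \bar R) -> (forall p, 0 <= Psi p)%E ->
  (\int[P]_(w in E) Psi (w, i w) = c%:E * \int[P]_w \int[D]_j Psi (w, j))%E.
Proof.
move=> mi mE c0 indep mPsi Psi0.
pose phi : Omega -> history G := fun w => (w, i w).
have mphi : measurable_fun setT phi by exact: measurable_history_graph.
have mid := measurable_history_id.
have mPsi' : measurable_fun setT (Psi : Omega * I -> \bar R).
  exact: (measurableT_comp mPsi mid).
pose m1f : {measure set (history G) -> \bar R} := pushforward (mrestr P mE) phi.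
pose m1 := m1f mphi.
pose m0f : {measure set (history G) -> \bar R} :=
  pushforward (P \x D)%E (id : Omega * I -> history G).
pose m0 := m0f mid.
pose m2 : {measure set (history G) -> \bar R} := mscale (NngNum c0) m0.
have m12 X : measurable X -> m1 X = m2 X.
  apply: (@measure_unique _ _ (history G) (history_rects G) (fun=> setT)) => //.
  - move=> _ _ [B [A [GB mA ->]]] [B' [A' [GB' mA' ->]]].
    exists (B `&` B'), (A `&` A'); rewrite setXI.
    by split; [exact: GI|exact: measurableI|].
  - by move=> _; exists setT, setT; rewrite setXTT.
  - by rewrite bigcup_const//; exists 0%N.
  - move=> _ [B [A [GB mA ->]]].
    rewrite /m1 /m2 /m0 /= /mscale /= /pushforward preimage_id.
    rewrite product_measure1E//; last exact: mG.
    rewrite -indep// /mrestr /=; congr (P _).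
    by apply/seteqP; split => w /=; rewrite /phi /=; tauto.
  - move=> _; rewrite /m1 /= /pushforward /mrestr.
    by apply: (@le_lt_trans _ _ 1%E); rewrite ?probability_le1 ?ltry//;
       apply: measurableI => //; rewrite preimage_setT.
have /= <- := ge0_integral_mrestr mE (measurableT_comp mPsi mphi) (fun w => Psi0 (phi w)).
have /= := ge0_integral_pushforward mphi (mrestr P mE) measurableT mPsi.
rewrite preimage_setT => <- //.
rewrite (eq_measure_integral m2) => [|A mA _]; last exact: m12.
rewrite ge0_integral_mscale//=; congr (_ * _)%E.
have /= := ge0_integral_pushforward mid (P \x D)%E measurableT mPsi.
rewrite preimage_setT => -> //.
by rewrite fubini_tonelli1.
Qed.

End independent_tonelli.

(** * Real random variables with a finite mean *)

Section mean.
Context {R : realType} {d : measure_display} {T : measurableType d}.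
Variable P : probability T R.
Implicit Types (phi psi : T -> R) (r s c : R).

(** Integrability and value are kept together, so that each linear rule below transfers both at
    once. *)
Definition mean_is phi r :=
  P.-integrable setT (EFin \o phi) /\ (\int[P]_w (phi w)%:E)%E = r%:E.

Lemma mean_is_Rintegral phi : P.-integrable setT (EFin \o phi) ->
  mean_is phi (Rintegral P setT phi).
Proof.
by move=> iphi; split=> //; rewrite /Rintegral fineK//; exact: integrable_fin_num.
Qed.

Lemma mean_is_unique phi r s : mean_is phi r -> mean_is phi s -> r = s.
Proof. by move=> [_ hr] [_]; rewrite hr => -[]. Qed.

Lemma mean_is_ext phi psi r : phi =1 psi -> mean_is phi r -> mean_is psi r.
Proof. by move=> /funext ->. Qed.

Lemma mean_is_cst c : mean_is (fun=> c) c.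
Proof.
split; first exact: finite_measure_integrable_cst.
by rewrite integral_cst//= probability_setT mule1.
Qed.

Lemma mean_isD phi psi r s : mean_is phi r -> mean_is psi s ->
  mean_is (fun w => phi w + psi w) (r + s).
Proof.
move=> [ip pr] [iq qs]; split.
  exact: (integrableD measurableT ip iq).
under eq_integral do rewrite EFinD.
by rewrite (integralD measurableT ip iq) /= pr qs.
Qed.

Lemma mean_isZ c phi r : mean_is phi r -> mean_is (fun w => c * phi w) (c * r).
Proof.
move=> [ip pr]; split; first exact: (integrableZl measurableT c ip).
under eq_integral do rewrite EFinM.
by rewrite (integralZl measurableT ip) pr.
Qed.

Lemma mean_isN phi r : mean_is phi r -> mean_is (fun w => - phi w) (- r).
Proof.
move=> /(mean_isZ (-1)); rewrite mulN1r.
by apply: mean_is_ext => w; rewrite mulN1r.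
Qed.

Lemma mean_isB phi psi r s : mean_is phi r -> mean_is psi s ->
  mean_is (fun w => phi w - psi w) (r - s).
Proof. by move=> hp /mean_isN; exact: mean_isD. Qed.

Lemma mean_is_sum k (phi : 'I_k -> T -> R) (r : 'I_k -> R) :
  (forall j, mean_is (phi j) (r j)) ->
  mean_is (fun w => \sum_(j < k) phi j w) (\sum_(j < k) r j).
Proof.
move=> H; elim: (index_enum _) => [|j l IH].
  rewrite big_nil; apply: (mean_is_ext _ (mean_is_cst 0)) => w.
  by rewrite big_nil.
rewrite big_cons; apply: (mean_is_ext _ (mean_isD (H j) IH)) => w.
by rewrite big_cons.
Qed.

Lemma mean_is_le phi psi r s : mean_is phi r -> mean_is psi s ->
  (forall w, phi w <= psi w) -> r <= s.
Proof.
move=> [ip pr] [iq qs] le; rewrite -lee_fin -pr -qs.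
by apply: le_integral => // w _; rewrite lee_fin.
Qed.

Lemma mean_is_ge0 phi r : mean_is phi r -> (forall w, 0 <= phi w) -> 0 <= r.
Proof. by move=> hp; exact: mean_is_le (mean_is_cst 0) hp. Qed.

(** The extended integral of a nonnegative measurable function always makes sense; a finite bound on
    it yields integrability. This is how finiteness passes from one iterate to the next. *)
Lemma mean_is_bounded phi s : measurable_fun setT phi -> (forall w, 0 <= phi w) ->
  (\int[P]_w (phi w)%:E <= s%:E)%E -> exists2 r, mean_is phi r & r <= s.
Proof.
move=> mphi p0 le.
have ip : P.-integrable setT (EFin \o phi).
  apply/integrableP; split; first exact/measurable_EFinP.
  under eq_integral do rewrite /= ger0_norm//.
  exact: le_lt_trans le (ltry _).
exists (Rintegral P setT phi); first exact: mean_is_Rintegral.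
by rewrite -lee_fin; have [_ <-] := mean_is_Rintegral ip.
Qed.

Lemma mean_is_dominated phi psi s : measurable_fun setT phi ->
  (forall w, 0 <= phi w <= psi w) -> mean_is psi s -> exists2 r, mean_is phi r & r <= s.
Proof.
move=> mphi le [iq qs]; apply: mean_is_bounded => // [w|].
  by have /andP[] := le w.
rewrite -qs; apply: ge0_le_integral => //.
- by move=> w _; rewrite lee_fin; have /andP[] := le w.
- exact/measurable_EFinP.
- by move: iq => /measurable_int.
- by move=> w _; rewrite lee_fin; have /andP[] := le w.
Qed.

End mean.

(** * Deterministic recursions for the last term of a sequence, and bounds on harmonic sums *)

Section last_iterate.
Context {R : realType}.

Definition tail_mean (al : nat -> R) (N k : nat) : R :=
  (\sum_(N - k <= t < N.+1) al t) / k.+1%:R.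

Definition harm (K : nat) : R := \sum_(1 <= k < K.+1) k%:R^-1.
Definition growth (dl : R) (K : nat) : R := \prod_(1 <= k < K.+1) (1 + dl / k%:R).

Lemma harm_ge0 K : 0 <= harm K.
Proof. by apply: sumr_ge0 => k _; rewrite invr_ge0. Qed.

Lemma growth_ge1 dl K : 0 <= dl -> 1 <= growth dl K.
Proof.
move=> dl0; rewrite /growth big_seq; elim/big_rec: _ => // k p _ p1.
by apply: (le_trans p1); rewrite ler_peMl ?(le_trans ler01 p1)// lerDl divr_ge0.
Qed.

Lemma harmS K : harm K.+1 = harm K + K.+1%:R^-1.
Proof. by rewrite /harm big_nat_recr. Qed.

Lemma growthS dl K : growth dl K.+1 = growth dl K * (1 + dl / K.+1%:R).
Proof. by rewrite /growth big_nat_recr. Qed.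

(* Telescoping the recursion started at [s = N - k] against [e s s = 0]. *)
Lemma tail_mean_le (al : nat -> R) (e : nat -> nat -> R) tau dl V N k :
  0 < tau -> (forall s, e s s = 0) -> (forall t s, 0 <= e t s) ->
  (forall t s, (s <= t)%N ->
     e t.+1 s <= e t s - 2 * tau * (al t - al s) + 2 * tau * dl * al t
                 + 2 * tau ^+ 2 * V) ->
  (k <= N)%N ->
  (1 - dl) * tail_mean al N k <= al (N - k)%N + tau * V.
Proof.
move=> tau0 e0 ege He kN; set s := (N - k)%N.
have H j : e (s + j)%N s <= - (2 * tau * (1 - dl) * \sum_(s <= t < s + j) al t)
             + j%:R * (2 * tau * al s + 2 * tau ^+ 2 * V).
  elim: j => [|j IH]; first by rewrite addn0 big_geq// e0 mulr0 mul0r oppr0 addr0.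
  rewrite addnS big_nat_recr ?leq_addr//= -natr1.
  by apply: (le_trans (He _ _ (leq_addr j s))); lra.
have := le_trans (ege _ _) (H k.+1).
rewrite addnS subnK// -/s => h.
rewrite /tail_mean -/s mulrA ler_pdivrMr ?ltr0n//.
have : 2 * tau * ((1 - dl) * \sum_(s <= t < N.+1) al t) <=
       2 * tau * ((al s + tau * V) * k.+1%:R) by lra.
by rewrite ler_pM2l//; lra.
Qed.

(** Splitting the first term off [tail_mean al N K.+1] and bounding it below by the hypothesis
    bounds each tail mean by the next longer one; the factors multiply to [growth] and the errors
    add up to [harm]. *)
Lemma last_le_tail_mean (al : nat -> R) (c dl : R) N :
  0 <= c -> 0 <= dl -> (forall t, 0 <= al t) ->
  (forall k, (k <= N)%N -> (1 - dl) * tail_mean al N k <= al (N - k)%N + c) ->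
  forall K, (K <= N)%N -> al N <= growth dl K * (tail_mean al N K + c * harm K).
Proof.
move=> c0 dl0 al0 H; elim => [_|K IH KN].
  rewrite /growth /harm !big_geq// mulr0 addr0 mul1r /tail_mean subn0.
  by rewrite big_nat1 divr1.
apply: (le_trans (IH (ltnW KN))); rewrite growthS harmS -mulrA.
apply: ler_wpM2l; first exact: le_trans ler01 (growth_ge1 K dl0).
have step : tail_mean al N K <= (1 + dl / K.+1%:R) * tail_mean al N K.+1 + c / K.+1%:R.
  have h := H _ KN.
  have E : tail_mean al N K.+1 * K.+2%:R = al (N - K.+1)%N + tail_mean al N K * K.+1%:R.
    rewrite /tail_mean !divfK ?pnatr_eq0// big_ltn; last first.
      by rewrite ltnS leq_subr.
    by rewrite subnSK.
  have p : 0 < K.+1%:R :> R by rewrite ltr0n.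
  rewrite -(ler_pM2r p).
  have -> : ((1 + dl / K.+1%:R) * tail_mean al N K.+1 + c / K.+1%:R) * K.+1%:R =
            (K.+1%:R + dl) * tail_mean al N K.+1 + c by field; rewrite gt_eqF.
  move: E; rewrite -[K.+2%:R]natr1; move: h.
  by move: (K.+1%:R) (al _) => a b h E; lra.
have h0 : 0 <= dl / K.+1%:R by rewrite divr_ge0.
(* The accumulated error is nonnegative, so it may be put under the new factor, which is at least
   [1]. *)
have h1 : 0 <= c * (harm K + K.+1%:R^-1).
  by rewrite mulr_ge0// addr_ge0 ?harm_ge0// invr_ge0.
have := mulr_ge0 h0 h1; move: step.
by move: (K.+1%:R^-1) (harm K) (tail_mean al N K) => a b d step'; lra.
Qed.

(** [e] stands for the mean squared distances between iterates, [e0] for those to the minimizer. The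
    former reduce [al N] to the mean of [al 0], ..., [al N]; the latter bound that mean. *)
Lemma last_iterate_bound (al e0 : nat -> R) (e : nat -> nat -> R) tau dl V N :
  0 < tau -> 0 <= dl -> dl < 1 -> 0 <= V -> (forall t, 0 <= al t) ->
  (forall s, e s s = 0) -> (forall t s, 0 <= e t s) -> (forall t, 0 <= e0 t) ->
  (forall t s, (s <= t)%N ->
     e t.+1 s <= e t s - 2 * tau * (al t - al s) + 2 * tau * dl * al t
                 + 2 * tau ^+ 2 * V) ->
  (forall t, e0 t.+1 <= e0 t - 2 * tau * (1 - dl) * al t + 2 * tau ^+ 2 * V) ->
  al N <= growth dl N * (e0 0%N / (2 * tau * (1 - dl) * N.+1%:R)
                         + tau * V / (1 - dl) + tau * V * harm N).
Proof.
move=> tau0 dl0 dl1 V0 al0 ess ege e0ge He He0.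
have dl1' : 0 < 1 - dl by rewrite subr_gt0.
have c0 : 0 <= tau * V by rewrite mulr_ge0// ltW.
have := @last_le_tail_mean al (tau * V) dl N c0 dl0 al0
  (fun k kN => tail_mean_le tau0 ess ege He kN) N (leqnn N).
move/le_trans; apply; apply: ler_wpM2l.
  exact: le_trans ler01 (growth_ge1 N dl0).
rewrite lerD2r /tail_mean subnn.
have H j : e0 j <= e0 0%N - 2 * tau * (1 - dl) * \sum_(0 <= t < j) al t
             + j%:R * (2 * tau ^+ 2 * V).
  elim: j => [|j IH]; first by rewrite big_geq// mulr0 mul0r subr0 addr0.
  rewrite big_nat_recr//= -natr1.
  by apply: (le_trans (He0 _)); lra.
have h := le_trans (e0ge _) (H N.+1).
have p : 0 < N.+1%:R :> R by rewrite ltr0n.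
rewrite ler_pdivrMr//.
have -> : (e0 0%N / (2 * tau * (1 - dl) * N.+1%:R) + tau * V / (1 - dl)) * N.+1%:R =
  (e0 0%N + N.+1%:R * (2 * tau ^+ 2 * V)) / (2 * tau * (1 - dl)).
  by field; rewrite -natr1 in p *; rewrite !gt_eqF//.
by rewrite ler_pdivlMr ?mulr_gt0//; lra.
Qed.

(** This is [1 + u <= expR u] at [u = - ln (k.+1 / k)]. *)
Lemma ln_succ_ge (k : nat) : (0 < k)%N -> k.+1%:R^-1 <= ln (k.+1%:R / k%:R) :> R.
Proof.
move=> k0.
have p : 0 < k%:R :> R by rewrite ltr0n.
have q : 0 < k.+1%:R :> R by rewrite ltr0n.
have := @expR_ge1Dx R (- ln (k.+1%:R / k%:R)).
rewrite expRN lnK ?posrE ?divr_gt0// invf_div => h.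
have E : k%:R / k.+1%:R = 1 - k.+1%:R^-1 :> R.
  by rewrite -[k.+1%:R]natr1 in q *; field; rewrite gt_eqF.
by rewrite E in h; move: (ln _) (k.+1%:R^-1) h => a b h; lra.
Qed.

(** [2] is the product of [4/3], [5/4] and [6/5], and [1/4 + 1/5 + 1/6 = 37/60]. The value is sharp
    enough for [harm 3 = 11/6 <= 3 * ln 2]. *)
Lemma ln2_ge : 37 / 60 <= ln 2 :> R.
Proof.
have h3 : 4^-1 <= ln (4 / 3) :> R := @ln_succ_ge 3 isT.
have h4 : 5^-1 <= ln (5 / 4) :> R := @ln_succ_ge 4 isT.
have h5 : 6^-1 <= ln (6 / 5) :> R := @ln_succ_ge 5 isT.
have -> : 2 = (4 / 3) * ((5 / 4) * (6 / 5)) :> R by field.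
by rewrite lnM ?posrE ?mulr_gt0// [X in _ <= _ + X]lnM ?posrE ?mulr_gt0//; lra.
Qed.

(** Induction from [T = 2]: the new term is at most the increment of [ln]. At [T = 1] the right side
    is [0], so that case is treated apart in the computation of the rate. *)
Lemma harm_le_ln T : (2 <= T)%N -> harm T.+1 <= 3 * ln T%:R.
Proof.
case: T => [//|[//|T]] _; elim: T => [|T IH].
  rewrite /harm 3?big_nat_recr//= big_geq//; have := ln2_ge; lra.
rewrite harmS.
have := @ln_succ_ge T.+2 isT.
rewrite ln_div ?posrE ?ltr0n// => h.
have : T.+4%:R^-1 <= T.+3%:R^-1 :> R by rewrite lef_pV2 ?posrE ?ltr0n// ler_nat.
have : 0 <= T.+3%:R^-1 :> R by rewrite invr_ge0.
move: (T.+4%:R^-1 : R) (T.+3%:R^-1 : R) (harm _) (ln T.+3%:R) (ln T.+2%:R) h IH.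
by move=> a b c u v h IH p q; lra.
Qed.

Lemma growth_le_expR dl K : 0 <= dl -> growth dl K <= expR (dl * harm K).
Proof.
move=> dl0; elim: K => [|K IH].
  by rewrite /growth /harm !big_geq// mulr0 expR0.
rewrite growthS harmS [dl * (_ + _)]mulrDr expRD; apply: ler_pM => //.
- exact: le_trans ler01 (growth_ge1 K dl0).
- by rewrite addr_ge0// divr_ge0.
- exact: expR_ge1Dx.
Qed.

(** This is [1 + u <= expR u] at [u = b * ln x - 1]; the shift by [1] produces the factor
    [expR 1]. *)
Lemma ln_le_powR (x b : R) : 0 < x -> 0 < b -> ln x <= x `^ b / (expR 1 * b).
Proof.
move=> x0 b0; rewrite ler_pdivlMr ?mulr_gt0 ?expR_gt0//.
have := @expR_ge1Dx R (b * ln x - 1); rewrite expRD expRN.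
have -> : 1 + (b * ln x - 1) = b * ln x by ring.
rewrite ler_pdivlMr ?expR_gt0// /powR gt_eqF//; lra.
Qed.

End last_iterate.

(** * Explicit constants of the rate *)

Section rate.
Context {R : realType}.
Variables (L C beta : R) (T : nat).
Hypotheses (L0 : 0 < L) (C4 : 4 < C) (beta0 : 0 < beta) (T1 : (1 <= T)%N).

Let Tr : R := T%:R.
Let tau : R := (C * L * Tr `^ beta)^-1.
Let dl : R := 4 / 3 * L * tau.
Let A : R := expR (4 / (expR 1 * beta * C)).

Let C0 : 0 < C. Proof. by apply: lt_trans C4. Qed.
Let C2 : 0 < C - 2. Proof. by rewrite subr_gt0 (lt_trans _ C4)// ltr_nat. Qed.
Let Tr1 : 1 <= Tr. Proof. by rewrite /Tr ler1n. Qed.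
Let Tr0 : 0 < Tr. Proof. exact: lt_le_trans Tr1. Qed.
Let X0 : 0 < Tr `^ beta. Proof. exact: powR_gt0. Qed.

Let X1 : 1 <= Tr `^ beta.
Proof. by rewrite -(powRr0 Tr); apply: ler_powR => //; exact: ltW. Qed.

Lemma step_size_gt0 : 0 < tau.
Proof. by rewrite /tau invr_gt0 !mulr_gt0. Qed.

Let dlE : dl = 4 / (3 * C * Tr `^ beta).
Proof. by rewrite /dl /tau; field; rewrite !gt_eqF. Qed.

Lemma rel_loss_ge0 : 0 <= dl.
Proof. by rewrite dlE divr_ge0// !mulr_ge0// ltW. Qed.

Lemma rel_loss_le : dl <= 1 / 3.
Proof.
rewrite dlE ler_pdivrMr ?mulr_gt0//.
have : 4 * 1 <= C * Tr `^ beta by apply: ler_pM => //; exact: ltW.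
lra.
Qed.

Let A1 : 1 <= A.
Proof.
rewrite /A -expR0 ler_expR divr_ge0// !mulr_ge0// ?ltW//; exact: expR_gt0.
Qed.

(** The [3] of [harm_le_ln] cancels the [3] in [dl = 4 / (3 C T^beta)], and [T^beta] cancels against
    [ln_le_powR], which leaves the exponent [4 / (e beta C)]. *)
Let growth_le : (2 <= T)%N -> growth dl T.+1 <= A.
Proof.
move=> T2; apply: (le_trans (growth_le_expR _ rel_loss_ge0)).
rewrite /A ler_expR.
have h := harm_le_ln T2; have h2 := ln_le_powR Tr0 beta0.
apply: (@le_trans _ _ (dl * (3 * (Tr `^ beta / (expR 1 * beta))))).
  apply: ler_wpM2l; first exact: rel_loss_ge0.
  by apply: (le_trans (h R)); rewrite ler_pM2l.
rewrite dlE le_eqVlt; apply/orP; left; apply/eqP.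
by field; rewrite !gt_eqF// expR_gt0.
Qed.

(** [14/9 = (1 + 1/3) * (1 + 1/6)] is the product at the upper bound [1/3] of [dl]. *)
Let growth1_le : T = 1%N -> growth dl T.+1 <= 14 / 9.
Proof.
move=> ->; rewrite /growth 2?big_nat_recr//= big_geq// mul1r divr1.
have := rel_loss_ge0; have := rel_loss_le; move: dl => d h1 h2.
by nra.
Qed.

Let ln2T : ln 2 <= ln (Tr + 1).
Proof. by rewrite ler_ln ?posrE//; [rewrite -[2]/(1 + 1) lerD2r|rewrite addr_gt0]. Qed.

(** The factor [3/4] bounds [1 / (2 (1 - dl))], and [Tr + 2] is [N + 1] for [N = T + 1]. For
    [T = 1], [14/9 * 1/4 <= 1 <= A] is used in place of [growth_le]. *)
Lemma growth_first_le : growth dl T.+1 * (3 / 4 / (Tr + 2)) <= A / Tr.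
Proof.
have [T2|] := ltnP 1 T.
  apply: ler_pM => //.
  - exact: le_trans ler01 (growth_ge1 _ rel_loss_ge0).
  - by rewrite divr_ge0// addr_ge0// ltW.
  - exact: growth_le.
  - by rewrite -[Tr^-1]mul1r ler_pdivrMr ?addr_gt0// mulrAC ler_pdivlMr//; move: Tr0; lra.
move=> Tle; have E : T = 1%N by apply/eqP; rewrite eqn_leq Tle.
have := growth1_le E; move: (growth _ _) => g h.
have -> : Tr = 1 by rewrite /Tr E.
have -> : 3 / 4 / (1 + 2) = 4^-1 :> R by field.
by rewrite divr1; have := A1; lra.
Qed.

(** The factor [3/2] bounds [1 / (1 - dl)]. For [T >= 2] it is absorbed by [3 * ln (Tr + 1)], hence
    [6] in place of [3]; for [T = 1] the left side is at most [14/9 * 3], which is below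
    [3/2 + 6 * 37/60]. *)
Lemma growth_noise_le :
  growth dl T.+1 * (3 / 2 + harm T.+1) <= A * (3 / (2 * Tr) + 6 * ln (Tr + 1)).
Proof.
have g0 : 0 <= growth dl T.+1 by exact: le_trans ler01 (growth_ge1 _ rel_loss_ge0).
have l2 := ln2T; have l2' := @ln2_ge R.
have [T2|] := ltnP 1 T.
  apply: ler_pM => //.
  - by rewrite addr_ge0// harm_ge0.
  - exact: growth_le.
  - have h := @harm_le_ln R _ T2.
    have : ln Tr <= ln (Tr + 1) by rewrite ler_ln ?posrE ?addr_gt0// lerDl.
    have : 0 <= 3 / (2 * Tr) by rewrite divr_ge0// mulr_ge0// ltW.
    move: h; rewrite -/Tr; move: (3 / (2 * Tr)) => u; lra.
move=> Tle; have E : T = 1%N by apply/eqP; rewrite eqn_leq Tle.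
have h := growth1_le E.
have -> : harm T.+1 = 3 / 2 :> R.
  by rewrite E /harm 2?big_nat_recr//= big_geq//; lra.
have -> : Tr = 1 by rewrite /Tr E.
have : Tr + 1 = 2 by rewrite /Tr E.
move: l2 => /[swap] -> _; rewrite -[1 + 1]/2.
have : 14 / 9 * 3 <= 3 / (2 * 1) + 6 * ln 2 :> R by lra.
have := A1; move: (ln 2) => u a1 h3.
have : 1 * (3 / (2 * 1) + 6 * u) <= A * (3 / (2 * 1) + 6 * u).
  by rewrite ler_wpM2r//; lra.
lra.
Qed.

Lemma rate_bound (a e0 h0 s2 q : R) :
  0 <= e0 -> 0 <= h0 -> 0 <= s2 -> 0 <= q ->
  let V := 8 / 3 * s2 + 8 * q in
  a <= growth dl T.+1 * (e0 / (2 * tau * (1 - dl) * T.+2%:R)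
         + tau * V / (1 - dl) + tau * V * harm T.+1) ->
  a <= A * (C * L * e0 / Tr `^ (1 - beta) + 2 / Tr * h0
      + 4 * s2 / ((C - 2) * L * Tr `^ (1 + beta))
      + 16 * s2 * ln (Tr + 1) / ((C - 2) * L * Tr `^ beta)
      + 16 * q / (C * L * Tr `^ (1 + beta))
      + 64 * q * ln (Tr + 1) / (C * L * Tr `^ beta)).
Proof.
move=> e0p h0p s20 q0 V /le_trans; apply.
have tau0 := step_size_gt0.
have d1 := rel_loss_le.
have d2 : 0 < 1 - dl by move: d1; lra.
have T2 : 0 < Tr + 2 by rewrite addr_gt0.
have V0 : 0 <= V by rewrite addr_ge0// mulr_ge0.
have g0 : 0 <= growth dl T.+1 by exact: le_trans ler01 (growth_ge1 _ rel_loss_ge0).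
have ln0 : 0 <= ln (Tr + 1) by rewrite ln_ge0// lerDr ltW.
have TV0 : 0 <= tau * V by rewrite mulr_ge0// ltW.
apply: (@le_trans _ _ (growth dl T.+1 * (3 / 4 / (Tr + 2) * (e0 / tau)
                        + tau * V * (3 / 2 + harm T.+1)))).
  apply: ler_wpM2l => //; rewrite [tau * V * (3 / 2 + _)]mulrDr addrA lerD2r; apply: lerD.
    have -> : e0 / (2 * tau * (1 - dl) * T.+2%:R) =
              (2 * (1 - dl))^-1 * (e0 / tau / (Tr + 2)).
      have -> : T.+2%:R = Tr + 2 by rewrite /Tr -natrD addn2.
      by field; rewrite !gt_eqF.
    have -> : 3 / 4 / (Tr + 2) * (e0 / tau) = 3 / 4 * (e0 / tau / (Tr + 2)).
      by field; rewrite !gt_eqF.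
    apply: ler_wpM2r; first by rewrite !divr_ge0// ?addr_ge0// ltW.
    by rewrite -[leRHS]invrK lef_pV2 ?posrE; lra.
  apply: ler_wpM2l => //.
  by rewrite -[leRHS]invrK lef_pV2 ?posrE; lra.
have Tn : Tr != 0 by rewrite gt_eqF.
have E1 : C * L * e0 / Tr `^ (1 - beta) = e0 / tau / Tr.
  rewrite powRB ?Tn ?implybT// powRr1 ?ltW// /tau.
  by field; rewrite !gt_eqF.
have E2 : Tr `^ (1 + beta) = Tr * Tr `^ beta.
  by rewrite powRD ?Tn ?implybT// powRr1// ltW.
(* Replacing [C] by the smaller [C - 2] in the denominator only enlarges the gradient noise
   terms. *)
have h1 : 4 * s2 * (tau / Tr) <= 4 * s2 / ((C - 2) * L * Tr `^ (1 + beta)).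
  rewrite ler_wpM2l ?mulr_ge0// /tau -invfM lef_pV2 ?posrE ?mulr_gt0// ?E2 ?mulr_gt0//.
  rewrite [leRHS](_ : _ = C * (L * Tr `^ beta * Tr)); last by ring.
  rewrite [leLHS](_ : _ = (C - 2) * (L * Tr `^ beta * Tr)); last by ring.
  by rewrite ler_pM2r ?mulr_gt0// gerBl.
have h2 : 16 * s2 * ln (Tr + 1) * tau <=
          16 * s2 * ln (Tr + 1) / ((C - 2) * L * Tr `^ beta).
  rewrite ler_wpM2l ?mulr_ge0// /tau lef_pV2 ?posrE ?mulr_gt0//.
  by rewrite !ler_pM2r// gerBl.
have h3 : 16 * q / (C * L * Tr `^ (1 + beta)) = 16 * q * (tau / Tr).
  by rewrite E2 /tau; field; rewrite !gt_eqF.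
have h4 : 64 * q * ln (Tr + 1) / (C * L * Tr `^ beta) = 64 * q * ln (Tr + 1) * tau.
  by [].
have eT0 : 0 <= e0 / tau by rewrite divr_ge0// ltW.
have n1 := ler_wpM2r eT0 growth_first_le.
have n2 := ler_wpM2l TV0 growth_noise_le.
apply: (@le_trans _ _ (A * (e0 / tau / Tr + tau * V * (3 / (2 * Tr) + 6 * ln (Tr + 1))))).
  rewrite [leLHS](_ : _ = growth dl T.+1 * (3 / 4 / (Tr + 2)) * (e0 / tau)
    + tau * V * (growth dl T.+1 * (3 / 2 + harm T.+1))); last by ring.
  apply: (le_trans (lerD n1 n2)); rewrite le_eqVlt; apply/orP; left; apply/eqP.
  by field; rewrite !gt_eqF.
apply: ler_wpM2l; first exact: le_trans ler01 A1.
have k1 : 0 <= 2 / Tr * h0 by rewrite mulr_ge0// divr_ge0// ltW.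
have k2 : 0 <= q * (tau / Tr) by rewrite mulr_ge0// divr_ge0// ltW.
have k3 : 0 <= q * ln (Tr + 1) * tau by rewrite !mulr_ge0// ltW.
rewrite E1 h3 h4.
(* With [V = 8/3 s2 + 8 q], the products [8/3 * 3/2 = 4] and [8/3 * 6 = 16] are the claimed
   numerators, while [8 * 3/2 = 12] and [8 * 6 = 48] stay below [16] and [64]. *)
have -> : tau * V * (3 / (2 * Tr) + 6 * ln (Tr + 1)) =
  4 * s2 * (tau / Tr) + 16 * s2 * ln (Tr + 1) * tau
  + 12 * (q * (tau / Tr)) + 48 * (q * ln (Tr + 1) * tau).
  by rewrite /V; field; rewrite gt_eqF.
move: (e0 / tau / Tr) (4 * s2 / _) h1 (16 * s2 * _ / _) h2 (2 / Tr * h0) k1.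
move: (tau / Tr) (ln _) k2 k3 => u v k2 k3 w1 w2 h1 w3 h2 w4 k1.
lra.
Qed.

End rate.

(** * Measurability and continuity of functions of row vectors *)

Section measurable_vectors.
Context {R : realType} {n : nat} {d : measure_display} {T : measurableType d}.
Implicit Types (y z : T -> 'rV[R]_n).

Lemma measurable_continuous_comp (phi : 'rV[R]_n -> R) y : continuous phi ->
  (forall k, measurable_fun setT (fun t => y t 0 k)) ->
  measurable_fun setT (fun t => phi (y t)).
Proof. by move=> cphi; apply: (@measurable_caratheodory _ _ _ _ (fun=> phi)). Qed.

Lemma measurable_dotv y z : (forall k, measurable_fun setT (fun t => y t 0 k)) ->
  (forall k, measurable_fun setT (fun t => z t 0 k)) ->
  measurable_fun setT (fun t => dotv (y t) (z t)).
Proof.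
by move=> my mz; apply: measurable_sum => k; exact: measurable_funM.
Qed.

Lemma measurable_rowB y z : (forall k, measurable_fun setT (fun t => y t 0 k)) ->
  (forall k, measurable_fun setT (fun t => z t 0 k)) ->
  forall k, measurable_fun setT (fun t => (y t - z t) 0 k).
Proof.
move=> my mz k; under eq_fun do rewrite !mxE.
exact: measurable_funB.
Qed.

End measurable_vectors.

Lemma sqnorm_le_norm (R : realType) (n : nat) (v : 'rV[R]_n) :
  sqnorm v <= n%:R * `|v| ^+ 2.
Proof.
rewrite /sqnorm /dotv.
have -> : n%:R * `|v| ^+ 2 = \sum_(k < n) `|v| ^+ 2.
  by rewrite sumr_const card_ord mulr_natl.
apply: ler_sum => k _; rewrite -expr2 -real_normK ?num_real// ler_sqr ?nnegrE//.
rewrite -[leRHS]/(mx_norm v) mx_normrE.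
exact: (le_bigmax _ (fun ij : 'I_1 * 'I_n => `|v ij.1 ij.2|) (0, k)).
Qed.

(** The topology of row vectors is that of the maximum norm, to which [enorm] is compared with the
    factor [sqrt n]; the [+ 1] in [c] keeps it positive when [K] or [n] is [0]. *)
Lemma lipschitz_continuous (R : realType) (n : nat) (phi : 'rV[R]_n -> R) (K : R) :
  (forall u v, `|phi u - phi v| <= K * enorm (u - v)) -> continuous phi.
Proof.
move=> lphi u; apply: (proj2 (@cvgrPdist_lt _ _ _ (nbhs u) _ phi (phi u))) => e e0.
pose c := `|K| * Num.sqrt n%:R + 1.
have c0 : 0 < c by rewrite ltr_wpDl// mulr_ge0.
have ec : 0 < e / c by rewrite divr_gt0.
near=> v.
have h : enorm (u - v) <= Num.sqrt n%:R * `|u - v|.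
  have -> : Num.sqrt n%:R * `|u - v| = Num.sqrt (n%:R * `|u - v| ^+ 2).
    by rewrite sqrtrM// sqrtr_sqr normr_id.
  by rewrite ler_wsqrtr// sqnorm_le_norm.
have : `|u - v| < e / c.
  by near: v; exact: (@cvgr_dist_lt _ _ _ (nbhs u) _ id u cvg_id _ ec).
rewrite ltr_pdivlMr// => hv.
apply: le_lt_trans hv; apply: (le_trans (lphi u v)).
apply: (@le_trans _ _ (`|K| * enorm (u - v))).
  by rewrite ler_wpM2r ?enorm_ge0// ler_norm.
apply: (@le_trans _ _ (`|K| * (Num.sqrt n%:R * `|u - v|))).
  by rewrite ler_wpM2l.
by rewrite /c mulrDr mulr1 mulrA [leRHS]addrC [`|u - v| * _]mulrC lerDr.
Unshelve. all: by end_near. Qed.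

Lemma convex_fun_sum (R : realType) (n m : nat) (G : nat -> 'rV[R]_n -> R) :
  (forall j, (j < m)%N -> convex_fun (G j)) ->
  convex_fun (fun u => \sum_(j < m) G j u).
Proof.
move=> cG u v t t0 t1; rewrite !mulr_sumr -big_split /=.
by apply: ler_sum => j _; exact: cG.
Qed.

(** * The incremental proximal method: one step in mean *)

Section incremental_prox.
Context {R : realType} {n : nat} {dI : measure_display} {I : measurableType dI}.
Variables (D : probability I R) (F : I -> 'rV[R]_n -> R).
Variables (GF : I -> 'rV[R]_n -> 'rV[R]_n) (L : R).
Variables (f : 'rV[R]_n -> R) (Gf : 'rV[R]_n -> 'rV[R]_n).
Variables (m : nat) (G : nat -> 'rV[R]_n -> R) (Lg : R) (xs : 'rV[R]_n) (tau : R).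
Hypothesis L0 : 0 < L.
Hypothesis cF : forall i, convex_fun (F i).
Hypothesis gF : forall i, is_gradient (F i) (GF i).
Hypothesis lF : forall i u v, enorm (GF i u - GF i v) <= L * enorm (u - v).
Hypothesis iF : forall u, D.-integrable setT (fun i => (F i u)%:E).
Hypothesis fE : forall u, f u = Rintegral D setT (fun i => F i u).
Hypothesis gf : is_gradient f Gf.
Hypothesis iGF : forall u k, D.-integrable setT (fun i => (GF i u 0 k)%:E).
Hypothesis GfE : forall u k, Gf u 0 k = Rintegral D setT (fun i => GF i u 0 k).
Hypothesis m0 : (0 < m)%N.
Hypothesis cG : forall j, (j < m)%N -> convex_fun (G j).
Hypothesis lG : forall j, (j < m)%N ->
  forall u v, `|G j u - G j v| <= Lg * enorm (u - v).
Hypothesis xs_min :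
  forall y, f xs + \sum_(j < m) G j xs <= f y + \sum_(j < m) G j y.
Hypothesis iS : D.-integrable setT (fun i => (sqnorm (GF i xs))%:E).
Hypothesis tau0 : 0 < tau.

Let h u := f u + \sum_(j < m) G j u.
Let M : R := m%:R.
Let sigma2 := Rintegral D setT (fun i => sqnorm (GF i xs)).
Let dl := 4 / 3 * L * tau.
Let V := 8 / 3 * sigma2 + 8 * (M ^+ 2 * Lg ^+ 2).

Let M0 : 0 < M. Proof. by rewrite /M ltr0n. Qed.

Definition step_loss (j : nat) (i : I) (u v : 'rV[R]_n) : R :=
  step_bound tau M Lg L (F i) (GF i) (G j) xs u v.

Definition mean_step_loss (j : nat) (u v : 'rV[R]_n) : R :=
  sqnorm (u - v) - 2 * tau * (f u - f v) - 2 * tau * M * (G j u - G j v)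
  + tau ^+ 2 * (8 / 3 * L * bregman f Gf u xs + 16 / 3 * sigma2)
  + 16 * tau ^+ 2 * M ^+ 2 * Lg ^+ 2.

(** Bound on the conditional mean of the squared distance from [x t.+1] to [v], given [x t = u]. *)
Definition drift (u v : 'rV[R]_n) : R :=
  sqnorm (u - v) - 2 * tau * (h u - h v) + 2 * tau * dl * (h u - h xs)
  + 2 * tau ^+ 2 * V.

Lemma step_loss_ge0 j i u v : (j < m)%N -> 0 <= step_loss j i u v.
Proof. by move=> jm; apply: step_bound_ge0 => //; exact: lG. Qed.

Lemma mean_is_F u : mean_is D (fun i => F i u) (f u).
Proof. by rewrite fE; exact: mean_is_Rintegral (iF u). Qed.

Lemma mean_is_bregman u : mean_is D (fun i => bregman (F i) (GF i) u xs)
  (bregman f Gf u xs).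
Proof.
apply: mean_isB; first by apply: mean_isB; exact: mean_is_F.
apply: mean_is_sum => k; rewrite mulrC.
apply: (@mean_is_ext _ _ _ _ (fun i => (u - xs) 0 k * GF i xs 0 k)) => [i|].
  by rewrite mulrC.
by apply: mean_isZ; rewrite GfE; exact: mean_is_Rintegral (iGF xs k).
Qed.

Lemma mean_is_step_loss j u v :
  mean_is D (fun i => step_loss j i u v) (mean_step_loss j u v).
Proof.
rewrite /step_loss /step_bound /mean_step_loss.
apply: mean_isD; last exact: mean_is_cst.
apply: mean_isD; last first.
  apply/mean_isZ/mean_isD; first exact/mean_isZ/mean_is_bregman.
  exact: mean_isZ (mean_is_Rintegral iS).
apply: mean_isB; last exact: mean_is_cst.
apply: mean_isB; first exact: mean_is_cst.
by apply: mean_isZ; apply: mean_isB; exact: mean_is_F.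
Qed.

Lemma mean_step_loss_ge0 j u v : (j < m)%N -> 0 <= mean_step_loss j u v.
Proof.
by move=> jm; apply: (mean_is_ge0 (mean_is_step_loss j u v)) => i; exact: step_loss_ge0.
Qed.

(** Optimality of [xs] bounds the linear term of the divergence by the variation of the sum of the
    [G j]. This is what turns the gradient noise away from [xs] into a multiple of the gap. *)
Lemma bregman_le_gap u : bregman f Gf u xs <= h u - h xs.
Proof.
have := minimizer_gradient_ge u gf (convex_fun_sum cG) xs_min.
by rewrite /bregman /h; lra.
Qed.

Lemma sum_mean_step_loss_le u v :
  \sum_(j < m) M^-1 * mean_step_loss j u v <= drift u v.
Proof.
have E : \sum_(j < m) M^-1 * mean_step_loss j u v =
    sqnorm (u - v) - 2 * tau * (h u - h v)
    + tau ^+ 2 * (8 / 3 * L * bregman f Gf u xs + 16 / 3 * sigma2)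
    + 16 * tau ^+ 2 * M ^+ 2 * Lg ^+ 2.
  (* [K] collects what does not depend on [j]; the weight [M^-1] cancels the factor [M] in front of
     [G j]. *)
  pose K := sqnorm (u - v) - 2 * tau * (f u - f v)
    + tau ^+ 2 * (8 / 3 * L * bregman f Gf u xs + 16 / 3 * sigma2)
    + 16 * tau ^+ 2 * M ^+ 2 * Lg ^+ 2.
  rewrite (eq_bigr (fun j : 'I_m => M^-1 * K - 2 * tau * (G j u - G j v))); last first.
    by move=> j _; rewrite /mean_step_loss /K; field; rewrite gt_eqF.
  rewrite sumrB sumr_const card_ord -mulr_sumr sumrB -(mulr_natl (M^-1 * K)) -/M.
  by rewrite mulVKf ?gt_eqF// /K /h; ring.
(* This coefficient equals [2 * tau * dl], that of the gap in [drift]. *)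
have c0 : 0 <= tau ^+ 2 * (8 / 3 * L) by rewrite !mulr_ge0 ?sqr_ge0// ltW.
have := ler_wpM2l c0 (bregman_le_gap u).
by rewrite E /drift /dl /V; lra.
Qed.

Lemma drift_ge0 u v : 0 <= drift u v.
Proof.
apply: le_trans (sum_mean_step_loss_le u v); apply: sumr_ge0 => j _.
by rewrite mulr_ge0 ?invr_ge0 ?(ltW M0)// mean_step_loss_ge0.
Qed.

Let cf : continuous f. Proof. exact: gradient_continuous gf. Qed.
Let cG' j : (j < m)%N -> continuous (G j).
Proof. by move=> jm; apply: (lipschitz_continuous (lG jm)). Qed.

Lemma measurable_objective d (T : measurableType d) (y : T -> 'rV[R]_n) :
  (forall k, measurable_fun setT (fun t => y t 0 k)) ->
  measurable_fun setT (fun t => h (y t)).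
Proof.
move=> my; apply: measurable_funD; first exact: measurable_continuous_comp.
apply: measurable_sum => j.
by apply: measurable_continuous_comp => //; exact: cG'.
Qed.

(** * The random trajectory and its past *)

Context {dO : measure_display} {Omega : measurableType dO}.
Variables (P : probability Omega R) (ii : nat -> Omega -> I) (jj : nat -> Omega -> nat).
Variables (x : nat -> Omega -> 'rV[R]_n) (x0 : 'rV[R]_n).
Hypothesis mii : forall t, measurable_fun setT (ii t).
Hypothesis mjj : forall t k, measurable [set w | jj t w = k].
Hypothesis jjm : forall t w, (jj t w < m)%N.
Hypothesis x_start : forall w, x 0%N w = x0.
Hypothesis x_prox : forall t w, is_prox (tau * m%:R) (G (jj t w))
  (x t w - tau *: GF (ii t w) (x t w)) (x t.+1 w).
Hypothesis mx : forall t k, measurable_fun setT (fun w => x t w 0 k).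
Hypothesis indep : forall t (A : set I) (k0 : nat) (S : nat -> 'I_n -> set R),
  measurable A -> (k0 < m)%N -> (forall s k, measurable (S s k)) ->
  let Ev := [set w | forall s, (s <= t)%N -> forall k, S s k (x s w 0 k)] in
  P ([set w | A (ii t w) /\ jj t w = k0] `&` Ev)
  = (D A * (m%:R^-1)%:E * P Ev)%E.

(** Cylinder events of the first iterates: a pi-system, in general not a sigma-algebra, in the exact
    form in which independence is assumed. *)
Definition past (t : nat) : set (set Omega) :=
  [set B | exists S : nat -> 'I_n -> set R, (forall s k, measurable (S s k)) /\
     B = [set w | forall s, (s <= t)%N -> forall k, S s k (x s w 0 k)]].

Lemma past_setI t : setI_closed (past t).
Proof.
move=> _ _ [S [mS ->]] [S' [mS' ->]].
exists (fun s k => S s k `&` S' s k); split; first by move=> s k; exact: measurableI.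
apply/seteqP; split => w /=.
  by move=> [a b] s st k; split; [exact: a|exact: b].
by move=> a; split => s st k; have [] := a s st k.
Qed.

Lemma past_setT t : past t setT.
Proof. by exists (fun _ _ => setT); split => //; apply/seteqP; split. Qed.

Lemma past_measurable t : past t `<=` measurable.
Proof.
move=> _ [S [mS ->]].
have -> : [set w | forall s, (s <= t)%N -> forall k, S s k (x s w 0 k)] =
  \bigcap_(s in [set` 'I_t.+1]) \bigcap_(k in [set` 'I_n])
     (fun w => x s w 0 k) @^-1` S s k.
  apply/seteqP; split => w /=.
    by move=> a s _ k _; apply: a; rewrite -ltnS.
  by move=> a s st k; have := a (Ordinal (st : (s < t.+1)%N)) isT k isT.
apply: fin_bigcap_measurable => // s _; apply: fin_bigcap_measurable => // k _.
by rewrite -[X in measurable X]setTI; exact: mx.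
Qed.

Lemma past_coord t s k (A : set R) : (s <= t)%N -> measurable A ->
  past t ((fun w => x s w 0 k) @^-1` A).
Proof.
move=> st mA; exists (fun s' k' => if (s' == s) && (k' == k) then A else setT).
split; first by move=> s' k'; case: ifP.
apply/seteqP; split => w /=.
  by move=> a s' s't k'; case: ifP => // /andP[/eqP -> /eqP ->].
by move=> /(_ s st k); rewrite !eqxx.
Qed.

(* [z] is determined by the iterates up to time [t]. *)
Definition adapted t (z : Omega -> 'rV[R]_n) := forall k,
  measurable_fun setT ((fun p => z p.1 0 k) : history (I := I) (past t) -> R).

Lemma adapted_iterate t s : (s <= t)%N -> adapted t (x s).
Proof.
move=> st k; apply: (measurable_history_fst (f := fun w => x s w 0 k)).
by move=> A mA; exact: past_coord.
Qed.

Lemma adapted_cst t (v : 'rV[R]_n) : adapted t (fun=> v).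
Proof. by move=> k; exact: measurable_cst. Qed.

Lemma adapted_measurable t z k : adapted t z -> measurable_fun setT (fun w => z w 0 k).
Proof.
move=> /(_ k) az.
exact: (measurableT_comp az (measurable_history_graph (@past_measurable t) (mii t))).
Qed.

Lemma measurable_mean_step_loss j (y z : Omega -> 'rV[R]_n) : (j < m)%N ->
  (forall k, measurable_fun setT (fun w => y w 0 k)) ->
  (forall k, measurable_fun setT (fun w => z w 0 k)) ->
  measurable_fun setT (fun w => mean_step_loss j (y w) (z w)).
Proof.
move=> jm my mz; rewrite /mean_step_loss /bregman /sqnorm.
have mf (u : Omega -> 'rV[R]_n) : (forall k, measurable_fun setT (fun w => u w 0 k)) ->
    measurable_fun setT (fun w : Omega => f (u w)).
  by move=> mu; exact: measurable_continuous_comp.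
have mG (u : Omega -> 'rV[R]_n) : (forall k, measurable_fun setT (fun w => u w 0 k)) ->
    measurable_fun setT (fun w : Omega => G j (u w)).
  by move=> mu; apply: measurable_continuous_comp => //; exact: cG'.
apply: measurable_funD; last exact: measurable_cst.
apply: measurable_funD; last first.
  apply: measurable_funM; first exact: measurable_cst.
  apply: measurable_funD; last exact: measurable_cst.
  apply: measurable_funM; first exact: measurable_cst.
  apply: measurable_funB.
    by apply: measurable_funB; [exact: mf|exact: measurable_cst].
  by apply: measurable_dotv => //; exact: (measurable_rowB (z := fun=> xs)).
apply: measurable_funB; last first.
  apply: measurable_funM; first exact: measurable_cst.
  by apply: measurable_funB; apply: mG.
apply: measurable_funB; last first.
  apply: measurable_funM; first exact: measurable_cst.
  by apply: measurable_funB; apply: mf.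
by apply: measurable_dotv; apply: measurable_rowB.
Qed.

Lemma measurable_drift (y z : Omega -> 'rV[R]_n) :
  (forall k, measurable_fun setT (fun w => y w 0 k)) ->
  (forall k, measurable_fun setT (fun w => z w 0 k)) ->
  measurable_fun setT (fun w => drift (y w) (z w)).
Proof.
move=> my mz; rewrite /drift /sqnorm.
apply: measurable_funD; last exact: measurable_cst.
apply: measurable_funD; last first.
  apply: measurable_funM; first exact: measurable_cst.
  by apply: measurable_funB; [exact: measurable_objective|exact: measurable_cst].
apply: measurable_funB; last first.
  apply: measurable_funM; first exact: measurable_cst.
  by apply: measurable_funB; exact: measurable_objective.
by apply: measurable_dotv; apply: measurable_rowB.
Qed.

(** Values of [F i] at a moving point are Caratheodory functions of index and history; the gradients
    enter only at the fixed point [xs], where integrability provides measurability. *)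
Lemma measurable_step_loss t j z : (j < m)%N -> adapted t z ->
  measurable_fun setT
    ((fun p => step_loss j p.2 (x t p.1) (z p.1)) : history (I := I) (past t) -> R).
Proof.
move=> jm az; have ax := adapted_iterate (leqnn t).
have msnd := @measurable_history_snd _ _ Omega I (past t) (past_setT t).
have mF u : measurable_fun setT (fun i => F i u).
  by apply/measurable_EFinP; exact: measurable_int (iF u).
have mFy (y : Omega -> 'rV[R]_n) : adapted t y ->
    measurable_fun setT ((fun p => F p.2 (y p.1)) : history (I := I) (past t) -> R).
  move=> ay; apply: (@measurable_caratheodory _ _ _ (history (I := I) (past t))
    (fun p => F p.2) (fun p => y p.1)) => // [v|p].
    exact: (measurableT_comp (mF v) msnd).
  exact: gradient_continuous (gF p.2).
have mGy (y : Omega -> 'rV[R]_n) : adapted t y ->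
    measurable_fun setT ((fun p => G j (y p.1)) : history (I := I) (past t) -> R).
  by move=> ay; apply: (@measurable_continuous_comp _ _ _ (history (I := I) (past t))
    (G j) (fun p => y p.1)) => //; exact: cG'.
have mGF k : measurable_fun setT
    ((fun p => GF p.2 xs 0 k) : history (I := I) (past t) -> R).
  apply: (measurableT_comp (f := fun i => GF i xs 0 k) _ msnd).
  by apply/measurable_EFinP; exact: measurable_int (iGF xs k).
rewrite /step_loss /step_bound /bregman /sqnorm.
apply: measurable_funD; last exact: measurable_cst.
apply: measurable_funD; last first.
  apply: measurable_funM; first exact: measurable_cst.
  apply: measurable_funD.
    apply: measurable_funM; first exact: measurable_cst.
    apply: measurable_funB.
      by apply: measurable_funB; apply: mFy => //; exact: adapted_cst.
    apply: (@measurable_dotv _ _ _ (history (I := I) (past t))) => //.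
    exact: (@measurable_rowB _ _ _ (history (I := I) (past t)) (fun p => x t p.1)
      (fun=> xs)).
  apply: measurable_funM; first exact: measurable_cst.
  exact: (@measurable_dotv _ _ _ (history (I := I) (past t))).
apply: measurable_funB; last first.
  apply: measurable_funM; first exact: measurable_cst.
  by apply: measurable_funB; apply: mGy.
apply: measurable_funB; last first.
  apply: measurable_funM; first exact: measurable_cst.
  by apply: measurable_funB; apply: mFy.
have mB k : measurable_fun setT
    ((fun p => (x t p.1 - z p.1) 0 k) : history (I := I) (past t) -> R).
  exact: (@measurable_rowB _ _ _ (history (I := I) (past t)) (fun p => x t p.1)).
exact: (@measurable_dotv _ _ _ (history (I := I) (past t))).
Qed.

(** The space is cut by the value [k] of [jj t]. On each piece the pointwise bound for [G k] holds,
    and independence replaces [ii t] by an average over [D] and the piece by the weight [1 / m]. *)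
Lemma integral_step_le t z : adapted t z ->
  (\int[P]_w (sqnorm (x t.+1 w - z w))%:E <= \int[P]_w (drift (x t w) (z w))%:E)%E.
Proof.
move=> az; have mz k := adapted_measurable k az.
pose E (k : 'I_m) := [set w | jj t w = k].
have cover : \big[setU/set0]_(k <- enum 'I_m) E k = [set: Omega].
  rewrite -subTset => w _; rewrite -bigcup_seq.
  exists (Ordinal (jjm t w)) => //=; by rewrite mem_enum.
have mlhs : measurable_fun setT (fun w => (sqnorm (x t.+1 w - z w))%:E).
  by apply/measurable_EFinP; apply: measurable_dotv; apply: measurable_rowB.
have mrhs (k : 'I_m) : measurable_fun setT (fun w => mean_step_loss k (x t w) (z w)).
  by apply: measurable_mean_step_loss => // l; exact: mx.
have mrhsM (k : 'I_m) :
    measurable_fun setT (fun w => (M^-1 * mean_step_loss k (x t w) (z w))%:E).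
  by apply/measurable_EFinP; apply: measurable_funM => //; exact: measurable_cst.
have rhs0 (k : 'I_m) w : 0 <= mean_step_loss k (x t w) (z w).
  exact: mean_step_loss_ge0.
have Mi0 : 0 <= M^-1 by rewrite invr_ge0 ltW.
rewrite -[in leLHS]cover ge0_integral_bigsetU//=; last 5 first.
- by move=> k; exact: mjj.
- exact: enum_uniq.
- by move=> k l _ _ [w []]; rewrite /E /= => -> /ord_inj.
- by rewrite cover.
- by move=> w _; rewrite lee_fin sqnorm_ge0.
apply: (@le_trans _ _ (\sum_(k <- enum 'I_m)
    \int[P]_w (M^-1 * mean_step_loss k (x t w) (z w))%:E)%E).
  apply: lee_sum => k _.
  have mPsi := measurable_step_loss (ltn_ord k) az.
  apply: (@le_trans _ _
    (\int[P]_(w in E k) (step_loss k (ii t w) (x t w) (z w))%:E)%E).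
    apply: ge0_le_integral => //.
    - exact: mjj.
    - by move=> w _; rewrite lee_fin sqnorm_ge0.
    - exact: measurable_funTS.
    - apply: measurable_funTS; apply/measurable_EFinP.
      exact: (measurableT_comp mPsi
        (measurable_history_graph (@past_measurable t) (mii t))).
    - move=> w Ek; rewrite lee_fin; apply: step_bound_prox => //.
      + exact: cG.
      + exact: lG.
      + by rewrite -Ek; exact: x_prox.
  have ind A B : measurable A -> past t B ->
      P (E k `&` ii t @^-1` A `&` B) = ((M^-1)%:E * (P B * D A))%E.
    move=> mA [S [mS ->]]; rewrite -[RHS]muleC (muleC (P _)) muleAC.
    rewrite -(indep t mA (ltn_ord k) mS); congr (P (_ `&` _)).
    by apply/seteqP; split => w /= [].
  have /= -> := independent_tonelli (@past_setI t) (past_setT t) (@past_measurable t)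
    (mii t) (mjj t k) Mi0 ind (proj2 (measurable_EFinP _ _) mPsi)
    (fun p => step_loss_ge0 _ _ _ (ltn_ord k)).
  under eq_integral do rewrite (proj2 (mean_is_step_loss k (x t _) (z _))).
  under [leRHS]eq_integral do rewrite EFinM.
  rewrite ge0_integralZl//; first exact/measurable_EFinP.
  by move=> w _; rewrite lee_fin.
rewrite -ge0_integral_sum//; last by move=> k w _; rewrite lee_fin mulr_ge0.
apply: ge0_le_integral => //.
- by move=> w _; apply: sume_ge0 => k _; rewrite lee_fin mulr_ge0.
- exact: emeasurable_sum.
- apply/measurable_EFinP; apply: measurable_drift => // l; exact: mx.
- move=> w _; rewrite sumEFin lee_fin big_enum /=.
  exact: sum_mean_step_loss_le.
Qed.

(** * Finite second moments and the gap at the last iterate *)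

Hypothesis dl1 : dl < 1.

Let gap t w := h (x t w) - h xs.

Let gap_ge0 t w : 0 <= gap t w.
Proof. by rewrite /gap subr_ge0; exact: xs_min. Qed.

Let V0 : 0 <= V.
Proof.
rewrite /V addr_ge0// mulr_ge0//; last by rewrite mulr_ge0// sqr_ge0.
by apply: Rintegral_ge0 => i _; exact: sqnorm_ge0.
Qed.

Let mdist t (z : Omega -> 'rV[R]_n) :
  (forall k, measurable_fun setT (fun w => z w 0 k)) ->
  measurable_fun setT (fun w => sqnorm (x t w - z w)).
Proof. by move=> mz; apply: measurable_dotv; apply: measurable_rowB. Qed.

Let driftE u : drift u xs =
  sqnorm (u - xs) - 2 * tau * (1 - dl) * (h u - h xs) + 2 * tau ^+ 2 * V.
Proof. by rewrite /drift; ring. Qed.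

Let coef_gt0 : 0 < 2 * tau * (1 - dl).
Proof. by rewrite !mulr_gt0// subr_gt0. Qed.

(** Nonnegativity of [drift (x t w) xs] dominates the gap by a multiple of the squared distance plus
    a constant, so the gap is integrable. Then [drift] has a finite mean, which by
    [integral_step_le] bounds the next squared distance. *)
Let mean_dist_step t e :
  mean_is P (fun w => sqnorm (x t w - xs)) e ->
  exists2 a, mean_is P (gap t) a &
    exists2 e', mean_is P (fun w => sqnorm (x t.+1 w - xs)) e' &
      e' <= e - 2 * tau * (1 - dl) * a + 2 * tau ^+ 2 * V.
Proof.
move=> He.
have [a Ha _] : exists2 a, mean_is P (gap t) a &
    a <= (2 * tau * (1 - dl))^-1 * (e + 2 * tau ^+ 2 * V).
  apply: mean_is_dominated; last first.
  - exact: mean_isZ (mean_isD He (mean_is_cst P _)).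
  - move=> w; rewrite gap_ge0 /= ler_pdivlMl// /gap.
    by have := drift_ge0 (x t w) xs; rewrite driftE; lra.
  - apply: measurable_funB; last exact: measurable_cst.
    by apply: measurable_objective => k; exact: mx.
exists a => //.
have Hd : mean_is P (fun w => drift (x t w) xs)
    (e - 2 * tau * (1 - dl) * a + 2 * tau ^+ 2 * V).
  apply: (mean_is_ext (fun w => esym (driftE (x t w)))).
  apply: mean_isD; last exact: mean_is_cst.
  by apply: mean_isB => //; exact: mean_isZ.
apply: mean_is_bounded.
- by apply: mdist => k; exact: measurable_cst.
- by move=> w; exact: sqnorm_ge0.
- by rewrite -(proj2 Hd); exact: (@integral_step_le t (fun=> xs) (@adapted_cst t xs)).
Qed.

Let mean_dist t : exists e, mean_is P (fun w => sqnorm (x t w - xs)) e.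
Proof.
elim: t => [|t [e /mean_dist_step[a _ [e' He' _]]]]; last by exists e'.
exists (sqnorm (x0 - xs)).
by apply: (mean_is_ext _ (mean_is_cst P _)) => w; rewrite x_start.
Qed.

Let gap_integrable t : mean_is P (gap t) (Rintegral P setT (gap t)).
Proof.
apply: mean_is_Rintegral.
by have [e /mean_dist_step[a []]] := mean_dist t.
Qed.

Let dist_integrable t : mean_is P (fun w => sqnorm (x t w - xs))
  (Rintegral P setT (fun w => sqnorm (x t w - xs))).
Proof. by apply: mean_is_Rintegral; have [e []] := mean_dist t. Qed.

Let pair_integrable t s : mean_is P (fun w => sqnorm (x t w - x s w))
  (Rintegral P setT (fun w => sqnorm (x t w - x s w))).
Proof.
apply: mean_is_Rintegral.
have [] // : exists2 r, mean_is P (fun w => sqnorm (x t w - x s w)) r &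
  r <= 2 * Rintegral P setT (fun w => sqnorm (x t w - xs)) +
       2 * Rintegral P setT (fun w => sqnorm (x s w - xs)).
  apply: mean_is_dominated; last first.
  - by apply: mean_isD; apply: mean_isZ; exact: dist_integrable.
  - by move=> w; rewrite sqnorm_ge0 sqnormB_le.
  - by apply: mdist => k; exact: mx.
by move=> r [].
Qed.

Lemma last_iterate_gap N :
  (\int[P]_w (h (x N w) - h xs)%:E <=
   (growth dl N * (sqnorm (x0 - xs) / (2 * tau * (1 - dl) * N.+1%:R)
      + tau * V / (1 - dl) + tau * V * harm N))%:E)%E.
Proof.
rewrite (proj2 (gap_integrable N)) lee_fin.
pose al t := Rintegral P setT (gap t).
pose e t s := Rintegral P setT (fun w => sqnorm (x t w - x s w)).
pose e0 t := Rintegral P setT (fun w => sqnorm (x t w - xs)).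
have e00 : e0 0%N = sqnorm (x0 - xs).
  apply: (mean_is_unique (dist_integrable 0)).
  by apply: (mean_is_ext _ (mean_is_cst P _)) => w; rewrite x_start.
rewrite -e00 -/(al N); apply: (@last_iterate_bound _ al e0 e) => //.
- by rewrite /dl !mulr_ge0// ltW.
- by move=> t; apply: Rintegral_ge0 => w _; exact: gap_ge0.
- move=> s; apply: (mean_is_unique (pair_integrable s s)).
  by apply: (mean_is_ext _ (mean_is_cst P 0)) => w; rewrite subrr sqnorm0.
- by move=> t s; apply: Rintegral_ge0 => w _; exact: sqnorm_ge0.
- by move=> t; apply: Rintegral_ge0 => w _; exact: sqnorm_ge0.
- move=> t s st.
  have Hd : mean_is P (fun w => drift (x t w) (x s w))
      (e t s - 2 * tau * (al t - al s) + 2 * tau * dl * al t + 2 * tau ^+ 2 * V).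
    apply: (@mean_is_ext _ _ _ _ (fun w => sqnorm (x t w - x s w)
      - 2 * tau * (gap t w - gap s w) + 2 * tau * dl * gap t w + 2 * tau ^+ 2 * V)).
      by move=> w; rewrite /drift /gap; ring.
    apply: mean_isD; last exact: mean_is_cst.
    apply: mean_isD; last exact: mean_isZ (gap_integrable t).
    apply: mean_isB; first exact: pair_integrable.
    by apply: mean_isZ; apply: mean_isB; exact: gap_integrable.
  rewrite -lee_fin -(proj2 Hd) -(proj2 (pair_integrable t.+1 s)).
  exact: integral_step_le (adapted_iterate st).
(* Uniqueness of the mean identifies the witnesses of [mean_dist_step] with [al t] and [e0 t.+1]. *)
- move=> t; have [a Ha [e' He' le]] := mean_dist_step (dist_integrable t).
  have <- : e' = e0 t.+1 by exact: mean_is_unique He' (dist_integrable t.+1).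
  by have <- : a = al t by exact: mean_is_unique Ha (gap_integrable t).
Qed.

End incremental_prox.

Unset Implicit Arguments.

Theorem theoremB1
  (R : realType) (n : nat)
  (* index set with distribution D *)
  (dI : measure_display) (I : measurableType dI) (D : probability I R)
  (F : I -> 'rV[R]_n -> R) (GF : I -> 'rV[R]_n -> 'rV[R]_n) (L : R)
  (f : 'rV[R]_n -> R) (Gf : 'rV[R]_n -> 'rV[R]_n)
  (m : nat) (G : nat -> 'rV[R]_n -> R) (Lg : R)
  (xs : 'rV[R]_n)
  (* probability space carrying the random indices and the iterates *)
  (dO : measure_display) (Omega : measurableType dO) (P : probability Omega R)
  (ii : nat -> Omega -> I) (jj : nat -> Omega -> nat)
  (x : nat -> Omega -> 'rV[R]_n) (x0 : 'rV[R]_n)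
  (T : nat) (C beta : R) :
  (* assumptions on f_i *)
  0 < L ->
  (forall i, convex_fun (F i)) ->
  (forall i, is_gradient (F i) (GF i)) ->
  (forall i u v, enorm (GF i u - GF i v) <= L * enorm (u - v)) ->
  (* f = E_{i ~ D} f_i, and E_{i ~ D} grad f_i = grad f *)
  (forall u, D.-integrable setT (fun i => (F i u)%:E)) ->
  (forall u, f u = Rintegral D setT (fun i => F i u)) ->
  is_gradient f Gf ->
  (forall u k, D.-integrable setT (fun i => (GF i u 0 k)%:E)) ->
  (forall u k, Gf u 0 k = Rintegral D setT (fun i => GF i u 0 k)) ->
  (* g = sum_{j < m} g_j, each convex and Lg-Lipschitz (hence proper, lsc) *)
  (0 < m)%N ->
  (forall j, (j < m)%N -> convex_fun (G j)) ->
  (forall j, (j < m)%N -> forall u v, `|G j u - G j v| <= Lg * enorm (u - v)) ->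
  (* x* is a minimizer of h = f + g, with sigma_*^2 finite *)
  (forall y, f xs + \sum_(j < m) G j xs <= f y + \sum_(j < m) G j y) ->
  D.-integrable setT (fun i => (sqnorm (GF i xs))%:E) ->
  (* step size parameters *)
  (1 <= T)%N -> 4 < C -> 0 < beta ->
  let Tr : R := T%:R in
  let tau : R := (C * L * Tr `^ beta)^-1 in
  let h := fun u => f u + \sum_(j < m) G j u in
  let hstar := h xs in
  let sigma2 := Rintegral D setT (fun i => sqnorm (GF i xs)) in
  (* the random indices *)
  (forall t, measurable_fun setT (ii t)) ->
  (forall t k, measurable [set w | jj t w = k]) ->
  (forall t w, (jj t w < m)%N) ->
  (* the iterates: deterministic start and the proximal recursion *)
  (forall w, x 0%N w = x0) ->
  (forall t w, is_prox (tau * m%:R) (G (jj t w))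
                 (x t w - tau *: GF (ii t w) (x t w)) (x t.+1 w)) ->
  (forall t k, measurable_fun setT (fun w => x t w 0 k)) ->
  (* i_t ~ D, j_t uniform on {0,...,m-1}, and i_t, j_t, (x_0,...,x_t) independent *)
  (forall t (A : set I) (k0 : nat) (S : nat -> 'I_n -> set R),
     measurable A -> (k0 < m)%N -> (forall s k, measurable (S s k)) ->
     let Ev := [set w | forall s, (s <= t)%N -> forall k, S s k (x s w 0 k)] in
     P ([set w | A (ii t w) /\ jj t w = k0] `&` Ev)
     = (D A * (m%:R^-1)%:E * P Ev)%E) ->
  let Aconst := expR (4 / (expR 1 * beta * C)) in
  (\int[P]_w (h (x T.+1 w) - hstar)%:E <=
   (Aconst *
     (C * L * sqnorm (x0 - xs) / Tr `^ (1 - beta)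
      + 2 / Tr * (h x0 - hstar)
      + 4 * sigma2 / ((C - 2) * L * Tr `^ (1 + beta))
      + 16 * sigma2 * ln (Tr + 1) / ((C - 2) * L * Tr `^ beta)
      + 16 * m%:R ^+ 2 * Lg ^+ 2 / (C * L * Tr `^ (1 + beta))
      + 64 * m%:R ^+ 2 * Lg ^+ 2 * ln (Tr + 1) / (C * L * Tr `^ beta)))%:E)%E.
Proof.
move=> L0 cF gF lF iF fE gf iGF GfE m0 cG lG xs_min iS T1 C4 beta0.
move=> Tr tau h hstar sigma2 mii mjj jjm x_start x_prox mx indep; cbv zeta.
have tau0 : 0 < tau by exact: step_size_gt0.
have dl_lt1 : 4 / 3 * L * tau < 1.
  by apply: le_lt_trans (rel_loss_le L0 C4 beta0 T1) _; lra.
apply: le_trans (last_iterate_gap L0 cF gF lF iF fE gf iGF GfE m0 cG lG xs_min iS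
  tau0 mii mjj jjm x_start x_prox mx indep dl_lt1 T.+1) _.
(* Regrouping [m ^+ 2 * Lg ^+ 2] as one factor gives the [q] of [rate_bound]. *)
rewrite lee_fin -![16 * _ * Lg ^+ 2]mulrA -![64 * _ * Lg ^+ 2]mulrA.
apply: rate_bound => //.
- exact: sqnorm_ge0.
- by rewrite subr_ge0; exact: xs_min.
- by apply: Rintegral_ge0 => i _; exact: sqnorm_ge0.
- by rewrite mulr_ge0// sqr_ge0.
Qed.
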